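(* Let $k$ be a field, let $c\ge 1$, let $\mathbf{a}_c=(a_1,\dots,a_c)$ be a sequence of integers with $a_i\ge 2$, let $\mathbf{q}=(q_{ij})$ be a $c\times c$ commutation matrix with entries in $k$, and let $A=A_{\mathbf{q}}^{\mathbf{a}_c}$ be the corresponding quantum complete intersection. Suppose that $A$ is symmetric and that all the commutators $q_{ij}$ are roots of unity. Then for all finitely generated left $A$-modules $M$ and $N$, the following are equivalent: (i) $\operatorname{Ext}_A^i(M,N)=0$ for $i\gg 0$; (ii) $\operatorname{Ext}_A^i(M,N)=0$ for all $i>0$; (iii) $\operatorname{Ext}_A^i(N,M)=0$ for $i\gg 0$; (iv) $\operatorname{Ext}_A^i(N,M)=0$ for all $i>0$.
   Context: A $c\times c$ commutation matrix over $k$ is a matrix $\mathbf{q}=(q_{ij})$ with entries in $k$ such that $q_{ii}=1$ for all $i$ and $q_{ij}q_{ji}=1$ for all $i,j$; its entries are called commutators. Given integers $a_1,\dots,a_c\ge 2$, the quantum complete intersection is the finite dimensional $k$-algebra $$A_{\mathbf{q}}^{\mathbf{a}_c}=k\langle X_1,\dots,X_c\rangle/(X_i^{a_i},\ X_iX_j-q_{ij}X_jX_i).$$ A finite dimensional $k$-algebra $\Lambda$ is symmetric if $\Lambda$ and its $k$-dual $D(\Lambda)=\operatorname{Hom}_k(\Lambda,k)$ are isomorphic as $\Lambda$-bimodules. *)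

(* Defs.v *)
From HB Require Import structures.
From mathcomp Require Import all_boot all_algebra.
From mathcomp Require Import boolp finmap.
From mathcomp Require Import monalg.

Set Implicit Arguments.
Unset Strict Implicit.
Unset Printing Implicit Defensive.

Import GRing.Theory.
Local Open Scope ring_scope.
Local Open Scope quotient_scope.

Section IdealQuotient.
Variables (k : comNzRingType) (R : algType k).

Inductive ideal_gen (S : R -> Prop) : R -> Prop :=
| ideal_gen_base x : S x -> ideal_gen S x
| ideal_gen0 : ideal_gen S 0
| ideal_genD x y : ideal_gen S x -> ideal_gen S y -> ideal_gen S (x + y)
| ideal_genM u x v : ideal_gen S x -> ideal_gen S (u * x * v).

Lemma ideal_genMl S u x : ideal_gen S x -> ideal_gen S (u * x).
Proof. by move=> /(ideal_genM u 1); rewrite mulr1. Qed.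

Lemma ideal_genMr S v x : ideal_gen S x -> ideal_gen S (x * v).
Proof. by move=> /(ideal_genM 1 v); rewrite mul1r. Qed.

Lemma ideal_genN S x : ideal_gen S x -> ideal_gen S (- x).
Proof. by rewrite -mulN1r; exact: ideal_genMl. Qed.

Variable S : R -> Prop.

Definition ideal_eqv : rel R := fun x y => `[< ideal_gen S (x - y) >].

Lemma ideal_eqv_class : equiv_class_of ideal_eqv.
Proof.
split=> [x|x y|y x z].
- by apply/asboolP; rewrite subrr; exact: ideal_gen0.
- by apply/asboolP/asboolP => /ideal_genN; rewrite opprB.
- move=> /asboolP xy /asboolP yz; apply/asboolP.
  by rewrite -(subrKA y); exact: ideal_genD.
Qed.

Canonical ideal_equiv := EquivRelPack ideal_eqv_class.

(* The properness hypothesis is part of the type because the library has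
   algebra structures over nontrivial rings only. *)
Definition quot_alg of ~ ideal_gen S 1 := {eq_quot ideal_equiv}.

Hypothesis proper : ~ ideal_gen S 1.
Let Q := quot_alg proper.

HB.instance Definition _ := Choice.on Q.
HB.instance Definition _ := EqQuotient.on Q.

Lemma quot_algP (x y : R) :
  reflect (ideal_gen S (x - y)) (\pi_Q x == \pi_Q y).
Proof. by rewrite eqmodE; exact: asboolP. Qed.

Let eqQ x y : ideal_gen S (x - y) -> \pi_Q x = \pi_Q y.
Proof. by move=> ?; apply/eqP/quot_algP. Qed.

Let Qeq (x : R) : ideal_gen S (repr (\pi_Q x) - x).
Proof. by apply/quot_algP; rewrite reprK. Qed.

Definition quot_zero : Q := \pi_Q 0.
Definition quot_opp (x : Q) : Q := \pi_Q (- repr x).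
Definition quot_add (x y : Q) : Q := \pi_Q (repr x + repr y).
Definition quot_one : Q := \pi_Q 1.
Definition quot_mul (x y : Q) : Q := \pi_Q (repr x * repr y).
Definition quot_scale (a : k) (x : Q) : Q := \pi_Q (a *: repr x).

Let oppE x : quot_opp (\pi_Q x) = \pi_Q (- x).
Proof. by apply: eqQ; rewrite -opprD; apply/ideal_genN/Qeq. Qed.

Let addE x y : quot_add (\pi_Q x) (\pi_Q y) = \pi_Q (x + y).
Proof. by apply: eqQ; rewrite opprD addrACA; apply: ideal_genD; apply: Qeq. Qed.

Let mulE x y : quot_mul (\pi_Q x) (\pi_Q y) = \pi_Q (x * y).
Proof.
apply: eqQ; set x' := repr _; set y' := repr _.
rewrite -(subrKA (x' * y)) -mulrBr -mulrBl.
by apply: ideal_genD; [apply: ideal_genMl | apply: ideal_genMr]; apply: Qeq.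
Qed.

Let scaleE a x : quot_scale a (\pi_Q x) = \pi_Q (a *: x).
Proof.
by apply: eqQ; rewrite -scalerBr -mulr_algl; apply: ideal_genMl; apply: Qeq.
Qed.

Let piS (P : Q -> Prop) : (forall x, P (\pi_Q x)) -> forall x, P x.
Proof. by move=> Ppi x; rewrite -[x]reprK. Qed.

Let addA : associative quot_add.
Proof. by do 3!elim/piS=> ?; rewrite !addE addrA. Qed.
Let addC : commutative quot_add.
Proof. by do 2!elim/piS=> ?; rewrite !addE addrC. Qed.
Let add0 : left_id quot_zero quot_add.
Proof. by elim/piS=> ?; rewrite addE add0r. Qed.
Let addN : left_inverse quot_zero quot_opp quot_add.
Proof. by elim/piS=> ?; rewrite oppE addE addNr. Qed.

HB.instance Definition _ := GRing.isZmodule.Build Q addA addC add0 addN.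

Let mulA : associative quot_mul.
Proof. by do 3!elim/piS=> ?; rewrite !mulE mulrA. Qed.
Let mul1 : left_id quot_one quot_mul.
Proof. by elim/piS=> ?; rewrite mulE mul1r. Qed.
Let mulx1 : right_id quot_one quot_mul.
Proof. by elim/piS=> ?; rewrite mulE mulr1. Qed.
Let mulDl : left_distributive quot_mul quot_add.
Proof. by do 3!elim/piS=> ?; rewrite !(addE, mulE) mulrDl. Qed.
Let mulDr : right_distributive quot_mul quot_add.
Proof. by do 3!elim/piS=> ?; rewrite !(addE, mulE) mulrDr. Qed.
Let one_neq0 : quot_one != 0.
Proof. by apply/negP=> /quot_algP; rewrite subr0. Qed.

HB.instance Definition _ :=
  GRing.Zmodule_isNzRing.Build Q mulA mul1 mulx1 mulDl mulDr one_neq0.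

Let scaleA a b v : quot_scale a (quot_scale b v) = quot_scale (a * b) v.
Proof. by elim/piS: v => ?; rewrite !scaleE scalerA. Qed.
Let scale1 : left_id 1 quot_scale.
Proof. by elim/piS=> ?; rewrite scaleE scale1r. Qed.
Let scaleDr : right_distributive quot_scale quot_add.
Proof. by move=> a; do 2!elim/piS=> ?; rewrite !(addE, scaleE) scalerDr. Qed.
Let scaleDl v a b :
  quot_scale (a + b) v = quot_add (quot_scale a v) (quot_scale b v).
Proof. by elim/piS: v => ?; rewrite !scaleE addE scalerDl. Qed.

HB.instance Definition _ :=
  GRing.Zmodule_isLmodule.Build k Q scaleA scale1 scaleDr scaleDl.

Let scaleAl a u v : quot_scale a (quot_mul u v) = quot_mul (quot_scale a u) v.
Proof.
by elim/piS: u => ?; elim/piS: v => ?; rewrite !(mulE, scaleE) scalerAl.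
Qed.

HB.instance Definition _ := GRing.Lmodule_isLalgebra.Build k Q scaleAl.

Let scaleAr a u v : quot_scale a (quot_mul u v) = quot_mul u (quot_scale a v).
Proof.
by elim/piS: u => ?; elim/piS: v => ?; rewrite !(mulE, scaleE) scalerAr.
Qed.

HB.instance Definition _ := GRing.Lalgebra_isAlgebra.Build k Q scaleAr.

End IdealQuotient.

Section QuantumCompleteIntersection.
Variables (k : fieldType) (c : nat).

Definition commutation_matrix (q : 'M[k]_c) : Prop :=
  (forall i, q i i = 1) /\ (forall i j, q i j * q j i = 1).

(* k<X_1, ..., X_c>, the monoid algebra of the free monoid on 'I_c. The alias
   is needed: on {malg _[_]} itself the library's algType structure is
   restricted to commutative monoids. *)
Definition free_alg : Type := {malg k[{fmonom 'I_c}]}.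

HB.instance Definition _ := GRing.Lalgebra.on free_alg.

Fact free_alg_scaleAr (b : k) (x y : free_alg) : b *: (x * y) = x * (b *: y).
Proof.
apply/malgP=> m; rewrite mcoeffZ mcoeffMl mulr_sumr.
rewrite (mcoeffMlw _ (fsubset_refl _) (msuppZ_le b y)).
apply: eq_bigr => i _; rewrite mulr_sumr; apply: eq_bigr => j _.
by rewrite mcoeffZ mulrnAr mulrCA.
Qed.

HB.instance Definition _ :=
  GRing.Lalgebra_isAlgebra.Build k free_alg free_alg_scaleAr.

Definition gen (i : 'I_c) : free_alg := << fmu i >>.

Variables (q : 'M[k]_c) (a : 'I_c -> nat).

Inductive qci_rel : free_alg -> Prop :=
| qci_rel_pow i : qci_rel (gen i ^+ a i)
| qci_rel_com i j : qci_rel (gen i * gen j - q i j *: (gen j * gen i)).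

Lemma qci_proper : (forall i, 2 <= a i)%N -> ~ ideal_gen qci_rel 1.
Proof.
move=> a_ge2 I1.
pose e : {rmorphism {malg k[{fmonom 'I_c}]} -> k} :=
  @mcoeff {fmonom 'I_c} k mone.
have e_gen i : e (gen i) = 0.
  rewrite /e /gen /= mcoeffU1 [_ == _](_ : _ = false) //.
  by apply/eqP=> /(congr1 (@fmonom_val _)); rewrite fmU fm1.
have e0 x : ideal_gen qci_rel x -> e x = 0.
  elim=> {x} [_ [i|i j]||x y _ ex _ ey|u x v _ ex].
  - by rewrite rmorphXn e_gen expr0n; case: (a i) (a_ge2 i).
  - by rewrite -mul_malgC rmorphB !rmorphM !e_gen !(mul0r, mulr0) subrr.
  - exact: rmorph0.
  - by rewrite rmorphD ex ey addr0.
  - by rewrite !rmorphM ex mulr0 mul0r.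
by have /eqP := e0 1 I1; rewrite rmorph1 oner_eq0.
Qed.

(* k<X_1, ..., X_c> / (X_i^(a_i), X_i X_j - q_ij X_j X_i) *)
Definition qci (a_ge2 : forall i, (2 <= a i)%N) : algType k :=
  quot_alg (qci_proper a_ge2).

End QuantumCompleteIntersection.

Section SymmetricAlgebra.
Variables (k : fieldType) (A : algType k).

Definition dual := {scalar A}.

(* The bimodule structure of D(A): (x f)(y) = f(y x) and (f x)(y) = f(x y). *)
Definition dual_lact_fun (x : A) (f : dual) : A -> k := fun y => f (y * x).
Definition dual_ract_fun (f : dual) (x : A) : A -> k := fun y => f (x * y).

Fact dual_lact_subproof x f : scalar (dual_lact_fun x f).
Proof. by move=> b y z; rewrite /dual_lact_fun mulrDl -scalerAl linearP. Qed.
Fact dual_ract_subproof f x : scalar (dual_ract_fun f x).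
Proof. by move=> b y z; rewrite /dual_ract_fun mulrDr -scalerAr linearP. Qed.

HB.instance Definition _ x f :=
  GRing.isLinear.Build k A k *%R (dual_lact_fun x f) (dual_lact_subproof x f).
HB.instance Definition _ f x :=
  GRing.isLinear.Build k A k *%R (dual_ract_fun f x) (dual_ract_subproof f x).

Definition dual_lact (x : A) (f : dual) : dual := dual_lact_fun x f.
Definition dual_ract (f : dual) (x : A) : dual := dual_ract_fun f x.

(* An isomorphism A -> D(A) of A-bimodules, equality in D(A) being pointwise.
   Its k-linearity follows from its A-linearity. *)
Definition symmetric_algebra : Prop :=
  exists phi : A -> dual,
    [/\ forall x y, phi (x + y) =1 phi x \+ phi y,
        forall x y, phi (x * y) =1 dual_lact x (phi y),
        forall x y, phi (x * y) =1 dual_ract (phi x) y,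
        forall x y, phi x =1 phi y -> x = y
      & forall f : dual, exists x, phi x =1 f].

End SymmetricAlgebra.

Section Ext.
Variable A : nzRingType.

Definition finitely_generated (M : lmodType A) : Prop :=
  exists n (v : 'I_n -> M),
    forall m, exists x : 'I_n -> A, m = \sum_(i < n) x i *: v i.

Definition projective (P : lmodType A) : Prop :=
  forall (U V : lmodType A) (g : {linear U -> V}) (f : {linear P -> V}),
    (forall v, exists u, g u = v) ->
    exists h : {linear P -> U}, forall p, g (h p) = f p.

Record proj_resolution (M : lmodType A) := ProjResolution {
  res_mod :> nat -> lmodType A;
  res_d : forall n, {linear res_mod n.+1 -> res_mod n};
  res_aug : {linear res_mod 0%N -> M};
  res_proj : forall n, projective (res_mod n);
  res_aug_surj : forall m, exists x, res_aug x = m;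
  res_exact0 : forall x, res_aug x = 0 <-> exists y, res_d 0 y = x;
  res_exact : forall n x, res_d n x = 0 <-> exists y, res_d n.+1 y = x
}.

(* Resolutions exist: iterate the free covers A^(M) -> M. *)
Section EnoughProjectives.

Section FreeLift.
Variables (T : choiceType) (U : lmodType A) (u : T -> U).

Definition free_lift_fun (x : {malg A[T]}) : U :=
  \sum_(t <- msupp x) x@_t *: u t.

Let free_liftEw (x : {malg A[T]}) (d : {fset T}) : (msupp x `<=` d)%fset ->
  free_lift_fun x = \sum_(t <- d) x@_t *: u t.
Proof.
move=> le_xd; rewrite /free_lift_fun (big_fset_incl _ le_xd) //= => t _.
by move=> /mcoeff_outdom ->; rewrite scale0r.
Qed.

Fact free_lift_subproof : linear free_lift_fun.
Proof.
move=> b x y.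
have le_x : (msupp x `<=` msupp x `|` msupp y)%fset by apply: fsubsetUl.
have le_y : (msupp y `<=` msupp x `|` msupp y)%fset by apply: fsubsetUr.
have le_xy : (msupp (b *: x + y)%R `<=` msupp x `|` msupp y)%fset.
  by apply: fsubset_trans (msuppD_le _ _) _; apply/fsetSU/msuppZ_le.
rewrite (free_liftEw le_x) (free_liftEw le_y) (free_liftEw le_xy).
rewrite scaler_sumr -big_split /=; apply: eq_bigr => t _.
by rewrite mcoeffD mcoeffZ scalerDl scalerA.
Qed.

HB.instance Definition _ := GRing.isLinear.Build A {malg A[T]} U *:%R
  free_lift_fun free_lift_subproof.

Definition free_lift : {linear {malg A[T]} -> U} := free_lift_fun.

Lemma free_liftU t : free_lift << t >> = u t.
Proof.
by rewrite /= (free_liftEw msuppU_le) big_seq_fset1 mcoeffUU scale1r.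
Qed.

End FreeLift.

Lemma free_projective (T : choiceType) : projective ({malg A[T]} : lmodType A).
Proof.
move=> U V g f g_surj; have [u gu] := choice (fun t => g_surj (f << t >>)).
exists (free_lift u) => x; rewrite [in RHS](monalgE x) linear_sum /=.
rewrite /free_lift_fun linear_sum; apply: eq_bigr => t _.
rewrite linearZ gu -linearZ; congr (f _).
by apply/malgP=> s; rewrite mcoeffZ !mcoeffU mulrnAr mulr1.
Qed.

Definition cover_map (M : lmodType A) : {linear {malg A[M]} -> M} :=
  free_lift id.

Section Syzygy.
Variable M : lmodType A.

Definition syz_pred : {pred {malg A[M]}} := fun x => cover_map M x == 0.

Fact syz_closed : submod_closed syz_pred.
Proof.
split=> [|b x y]; rewrite !unfold_in ?linear0 // linearP.
by move=> /eqP-> /eqP->; rewrite scaler0 addr0.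
Qed.

HB.instance Definition _ :=
  GRing.isSubmodClosed.Build A {malg A[M]} syz_pred syz_closed.

Record syz_type := Syz { syz_val : {malg A[M]}; _ : syz_val \in syz_pred }.
HB.instance Definition _ := [isSub for syz_val].
HB.instance Definition _ := [Choice of syz_type by <:].
HB.instance Definition _ := [SubChoice_isSubLmodule of syz_type by <:].

End Syzygy.

Definition syz (M : lmodType A) : lmodType A := syz_type M.
Definition syz_incl (M : lmodType A) : {linear syz M -> {malg A[M]}} := val.

Lemma exists_resolution (M : lmodType A) : inhabited (proj_resolution M).
Proof.
pose P n : lmodType A := {malg A[iter n syz M]}.
pose d n : {linear P n.+1 -> P n} :=
  syz_incl (iter n syz M) \o cover_map (iter n.+1 syz M).
have surj (X : lmodType A) m : exists x, cover_map X x = m.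
  by exists << m >>; exact: free_liftU.
have kerE (X : lmodType A) (x : {malg A[X]}) :
    cover_map X x = 0 <-> exists y, syz_incl X (cover_map (syz X) y) = x.
  split=> [/eqP x0|[y <-]]; last by apply/eqP; exact: (valP (cover_map _ y)).
  by have [y yx] := surj (syz X) (Syz x0); exists y; rewrite yx.
split; refine (@ProjResolution M P d (cover_map M) _ (surj M) (kerE M) _).
- by move=> n; apply: free_projective.
- move=> n x; rewrite -kerE; split=> [x0|/= ->].
    by apply: val_inj; exact: etrans x0 (esym (raddf0 (syz_incl _))).
  exact: raddf0 (syz_incl _).
Qed.

End EnoughProjectives.

Section Cohomology.
Variables (M N : lmodType A) (P : proj_resolution M).

Definition cocycle i (f : {linear P i -> N}) : Prop :=
  forall x, f (res_d P i x) = 0.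

Definition coboundary i : {linear P i -> N} -> Prop :=
  match i with
  | 0 => fun f => forall x, f x = 0
  | j.+1 => fun f =>
      exists g : {linear P j -> N}, forall x, f x = g (res_d P j x)
  end.

End Cohomology.

(* Ext^i(M, N) = 0, i.e. H^i(Hom_A(P, N)) = 0. By the comparison theorem this
   does not depend on the projective resolution P of M; one exists by
   exists_resolution. *)
Definition Ext_eq0 i (M N : lmodType A) : Prop :=
  forall (P : proj_resolution M) (f : {linear P i -> N}),
    cocycle f -> coboundary f.

End Ext.

(* Main.v *)
(* Eventual vanishing of Ext(M, N) implies vanishing in all positive degrees,
   by periodicity. Let B be the subalgebra generated by the X_l with l != i,
   and write sigma for the automorphism X_l |-> q_li^(a_i) X_l of A. There is
   an exact sequence 0 -> M^sigma -> I' -> I -> M -> 0 in which I and I' are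
   induced from twists of M restricted to B. As sigma has finite order n,
   splicing n such sequences gives a map Omega^(2n) M -> M whose cone K is
   projective over the subalgebra generated by s and X_i as soon as M is
   projective over the one generated by a set s of variables not containing
   X_i. By induction on the number of variables outside s, Ext^j(K, N) = 0 for
   all j > 0, so that the vanishing of Ext^j(M, N) follows from that of
   Ext^(j+2n)(M, N).

   Passing from (M, N) to (N, M) is Tate duality. For free modules F of finite
   rank the symmetrizing form t gives a natural duality between Hom_A(F, N) and
   Hom_A(N, F), namely the t-trace of the composite F -> N -> F. Applied to a
   coresolution of M by such F, it turns exactness of Hom(-, N), which holds
   since the cosyzygies of M also have eventually vanishing Ext into N, into
   exactness of Hom(N, -). *)

From HB Require Import structures.
Require Import Defs.
From mathcomp Require Import all_boot all_algebra.
From mathcomp Require Import boolp classical_sets finmap monalg.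

Set Implicit Arguments.
Unset Strict Implicit.
Unset Printing Implicit Defensive.

Import GRing.Theory.
Local Open Scope ring_scope.

(** * Vanishing of Ext by extension of maps *)

Section LinearMaps.
Variable A : nzRingType.
Implicit Types U V W X Y Z E N T P Q : lmodType A.

Definition mklin U V (f : U -> V) (f_lin : linear f) : {linear U -> V} :=
  HB.pack f (GRing.isLinear.Build A U V *:%R f f_lin).

Definition ses Z E X (i : {linear Z -> E}) (p : {linear E -> X}) : Prop :=
  [/\ injective i, forall x, exists e, p e = x
    & forall e, p e = 0 <-> exists z, i z = e].

Lemma ses0 Z E X (i : {linear Z -> E}) (p : {linear E -> X}) :
  ses i p -> forall z, p (i z) = 0.
Proof. by case=> _ _ ex z; apply/ex; exists z. Qed.

Lemma lin_inj U V (f : {linear U -> V}) :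
  (forall u, f u = 0 -> u = 0) -> injective f.
Proof.
move=> f0 x y fxy; apply/eqP; rewrite -subr_eq0; apply/eqP/f0.
by rewrite linearB fxy subrr.
Qed.

Lemma ker_factor E X N (p : {linear E -> X}) (f : {linear E -> N}) :
  (forall x, exists e, p e = x) -> (forall e, p e = 0 -> f e = 0) ->
  exists g : {linear X -> N}, forall e, g (p e) = f e.
Proof.
move=> p_surj pf; have [s sP] := choice p_surj.
have fE e e' : p e = p e' -> f e = f e'.
  move=> pe; apply/eqP; rewrite -subr_eq0 -linearB.
  by apply/eqP/pf; rewrite linearB pe subrr.
have g_lin : linear (f \o s).
  by move=> b x y /=; rewrite -linearP; apply: fE; rewrite linearP !sP.
by exists (mklin g_lin) => e /=; apply: fE; rewrite sP.
Qed.

Lemma inj_lift Z E Y (i : {linear Z -> E}) (g : {linear Y -> E}) :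
  injective i -> (forall y, exists z, i z = g y) ->
  exists h : {linear Y -> Z}, forall y, i (h y) = g y.
Proof.
move=> i_inj /choice[h hP].
have h_lin : linear h by move=> b x y; apply: i_inj; rewrite linearP !hP linearP.
by exists (mklin h_lin).
Qed.

Lemma ker_lift Z E X Y (i : {linear Z -> E}) (p : {linear E -> X})
    (g : {linear Y -> E}) :
  ses i p -> (forall y, p (g y) = 0) ->
  exists h : {linear Y -> Z}, forall y, i (h y) = g y.
Proof.
by case=> i_inj _ ex pg; apply: inj_lift => // y; apply/ex.
Qed.

Section Kernel.
Variables (E X : lmodType A) (p : {linear E -> X}).

Definition ker_pred : {pred E} := fun x => p x == 0.

Fact ker_closed : submod_closed ker_pred.
Proof.
split=> [|b x y]; rewrite !unfold_in ?linear0 // linearP.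
by move=> /eqP-> /eqP->; rewrite scaler0 addr0.
Qed.

HB.instance Definition _ :=
  GRing.isSubmodClosed.Build A E ker_pred ker_closed.

Record ker_type := Ker { ker_val : E; _ : ker_val \in ker_pred }.
HB.instance Definition _ := [isSub for ker_val].
HB.instance Definition _ := [Choice of ker_type by <:].
HB.instance Definition _ := [SubChoice_isSubLmodule of ker_type by <:].

Definition ker_incl : {linear ker_type -> E} := val.

Lemma ker_inclP e : p e = 0 <-> exists z, ker_incl z = e.
Proof.
by split=> [/eqP pe|[z <-]]; [exists (Ker pe) | exact/eqP/(valP z)].
Qed.

Lemma ker_ses : (forall x, exists e, p e = x) -> ses ker_incl p.
Proof. by move=> p_surj; split=> //; [exact: val_inj | exact: ker_inclP]. Qed.

End Kernel.

Section Pairs.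
Variables (U V W : lmodType A).

Definition pair_lin (f : {linear W -> U}) (g : {linear W -> V}) :
  {linear W -> (U * V)%type}.
Proof.
by refine (@mklin _ _ (fun w => (f w, g w)) _) => b x y; rewrite !linearP.
Defined.

Definition copair_lin (f : {linear U -> W}) (g : {linear V -> W}) :
  {linear (U * V)%type -> W}.
Proof.
refine (@mklin _ _ (fun w => f w.1 + g w.2) _) => b x y /=.
by rewrite !linearP scalerDr addrACA.
Defined.

Definition fst_lin : {linear (U * V)%type -> U} := fst.
Definition snd_lin : {linear (U * V)%type -> V} := snd.
End Pairs.

Definition sub_lin U V (f g : {linear U -> V}) : {linear U -> V} := f \- g.
Definition comp_lin U V W (g : {linear V -> W}) (f : {linear U -> V}) :
  {linear U -> W} := g \o f.
Definition id_lin U : {linear U -> U} := idfun.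
Definition zero_lin U V : {linear U -> V} := \0.

Lemma projective_pair (P Q : lmodType A) :
  projective P -> projective Q -> projective (P * Q)%type.
Proof.
move=> Pp Qp U V g f g_surj.
have [h1 h1P] := Pp U V g (comp_lin f (pair_lin (id_lin P) (zero_lin P Q))) g_surj.
have [h2 h2P] := Qp U V g (comp_lin f (pair_lin (zero_lin Q P) (id_lin Q))) g_surj.
exists (copair_lin h1 h2) => -[x y] /=; rewrite linearD h1P h2P /= -linearD.
by congr (f _); rewrite /GRing.add /= /add_pair /= addr0 add0r.
Qed.

Lemma projective_retract (P Q : lmodType A) (i : {linear Q -> P})
    (r : {linear P -> Q}) :
  (forall x, r (i x) = x) -> projective P -> projective Q.
Proof.
move=> ri Pp U V g f g_surj.
have [h hP] := Pp U V g (comp_lin f r) g_surj.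
by exists (comp_lin h i) => x /=; rewrite hP /= ri.
Qed.

Lemma projective_split Z E P (i : {linear Z -> E}) (p : {linear E -> P}) :
  projective P -> ses i p ->
  exists (s : {linear P -> E}) (r : {linear E -> Z}),
    [/\ forall x, p (s x) = x, forall z, r (i z) = z
      & forall e, e = i (r e) + s (p e)].
Proof.
move=> Pp sip; have [i_inj p_surj ex] := sip.
have [s sP] := Pp _ _ p (id_lin P) p_surj.
have pr0 e : p (sub_lin (id_lin E) (comp_lin s p) e) = 0.
  by rewrite /= linearB sP subrr.
have [r rP] := ker_lift sip pr0.
exists s, r; split=> // [z|e]; last by rewrite rP /= subrK.
by apply: i_inj; rewrite rP /= (ses0 sip) linear0 subr0.
Qed.

Lemma free_cover X : exists (P : lmodType A) (p : {linear P -> X}),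
  projective P /\ forall x, exists e, p e = x.
Proof.
exists ({malg A[X]} : lmodType A), (cover_map X); split.
  exact: free_projective.
by move=> x; exists << x >>; exact: free_liftU.
Qed.

Lemma projective_presentation X :
  exists (Z P : lmodType A) (i : {linear Z -> P}) (p : {linear P -> X}),
    projective P /\ ses i p.
Proof.
have [P [p [Pp p_surj]]] := free_cover X.
by exists (ker_type p), P, (ker_incl p), p; split=> //; exact: ker_ses.
Qed.

(* Ext^1(X, N) = 0 *)
Definition ext1 X N : Prop :=
  forall Z E (i : {linear Z -> E}) (p : {linear E -> X}) (f : {linear Z -> N}),
    ses i p -> exists g : {linear E -> N}, forall z, g (i z) = f z.

(* Ext^(n+1)(X, N) = 0 *)
Fixpoint extv (n : nat) X N : Prop :=
  match n with
  | 0 => ext1 X N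
  | m.+1 => forall Z P (i : {linear Z -> P}) (p : {linear P -> X}),
      projective P -> ses i p -> extv m Z N
  end.

(** Every extension of [X] by [Z'] is a quotient of [Z' * P], because [P] maps to it over [X]. The
    required map is therefore built on [Z' * P] and checked to vanish on the kernel. *)
Lemma ext1_presentation X N Z P (i : {linear Z -> P}) (p : {linear P -> X}) :
  projective P -> ses i p ->
  (forall f : {linear Z -> N},
    exists g : {linear P -> N}, forall z, g (i z) = f z) ->
  ext1 X N.
Proof.
move=> Pp sip ext Z' E i' p' f sip'.
have [h hP] := Pp _ _ p' p (let: And3 _ s _ := sip' in s).
have [h' h'P] := ker_lift (g := comp_lin h i) sip'
  (fun z => etrans (hP (i z)) (ses0 sip z)).
have [g gP] := ext (comp_lin f h').
have [i'_inj p'_surj ex'] := sip'; have [i_inj p_surj ex] := sip.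
have s_surj e : exists u, copair_lin i' h u = e.
  have [u pu] := p_surj (p' e).
  have /ex'[z zP] : p' (e - h u) = 0 by rewrite linearB hP pu subrr.
  by exists (z, u); rewrite /= zP subrK.
have [|l lP] := @ker_factor _ _ N (copair_lin i' h) (copair_lin f g) s_surj.
  move=> [z u] /= e0; have /ex[w uE] : p u = 0.
    by have := congr1 p' e0; rewrite linearD (ses0 sip') add0r hP linear0.
  move: e0; rewrite -uE gP -[h _]h'P -linearD -[X in _ = X](linear0 i').
  by move=> /i'_inj e0; rewrite /= -linearD e0 linear0.
by exists l => z; have := lP (z, 0); rewrite /= !linear0 !addr0.
Qed.

(** * Exactness and dimension shifting for vanishing Ext *)

Section Ext.
Variable N : lmodType A.

Lemma extv_projective n X : projective X -> extv n X N.
Proof.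
elim: n X => [|n IH] X Xp /= Z E i p.
  move=> f sip; have [s [r [_ ri _]]] := projective_split Xp sip.
  by exists (comp_lin f r) => z /=; rewrite ri.
move=> Ep sip; have [s [r [_ ri _]]] := projective_split Xp sip.
exact/IH/(projective_retract ri).
Qed.

(** The splitting identifies [E] with [Z * Q], so adding [Q] to the middle term turns a short exact
    sequence ending in [Z] into one ending in [E] with the same kernel. *)
Lemma extv_split n Z E Q (i : {linear Z -> E}) (p : {linear E -> Q}) :
  projective Q -> ses i p -> extv n E N -> extv n Z N.
Proof.
move=> Qp sip; have [s [r [ps ri dec]]] := projective_split Qp sip.
have key T P (j : {linear T -> P}) (q : {linear P -> Z}) : ses j q ->
    ses (pair_lin j (zero_lin T Q)) (copair_lin (comp_lin i q) s).
  case=> j_inj q_surj exq; split=> [x y [/j_inj]//|e|[u v] /=].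
    have [u uP] := q_surj (r e); exists (u, p e).
    by rewrite /= uP -dec.
  split=> [e0|[t [<- <-]]]; last first.
    by rewrite linear0 addr0 (_ : q _ = 0) ?linear0 //; apply/exq; exists t.
  have v0 : v = 0.
    by have := congr1 p e0; rewrite linearD ps (ses0 sip) add0r linear0.
  move: e0; rewrite v0 linear0 addr0 => /(congr1 r); rewrite ri linear0.
  by move=> /exq[t <-]; exists t.
case: n => [|n] /= extE T P j q.
  move=> f /key sjq; have [g gP] := extE _ _ _ _ f sjq.
  exists (comp_lin g (pair_lin (id_lin P) (zero_lin P Q))) => t /=.
  by rewrite -gP.
move=> Pp /key; apply: extE; exact: projective_pair.
Qed.

(** As in Schanuel's lemma, [Y] is the fibre product of [E] and [Q] over [X], read as an extension
    in two ways. *)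
Lemma ses_pullback Z E X Q (i : {linear Z -> E}) (p : {linear E -> X})
    (T : lmodType A) (j : {linear T -> Q}) (q : {linear Q -> X}) :
  ses i p -> ses j q ->
  exists (Y : lmodType A) (i1 : {linear Z -> Y}) (p1 : {linear Y -> Q})
    (i2 : {linear T -> Y}) (p2 : {linear Y -> E}), ses i1 p1 /\ ses i2 p2.
Proof.
move=> sip sjq; have [i_inj p_surj ex] := sip; have [j_inj q_surj exq] := sjq.
pose k : {linear (E * Q)%type -> X} :=
  sub_lin (comp_lin p (fst_lin E Q)) (comp_lin q (snd_lin E Q)).
pose Y := ker_type k; pose v := ker_incl k.
have vP (w : E * Q) : p w.1 = q w.2 -> exists y, v y = w.
  by move=> pq; apply/ker_inclP; rewrite /= pq subrr.
have vE y : p (v y).1 = q (v y).2.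
  by apply/eqP; rewrite -subr_eq0; apply/eqP/(ker_inclP k); exists y.
have v_inj : injective v by exact: val_inj.
have [i1 i1P] := @inj_lift Y _ Z v (pair_lin i (zero_lin Z Q)) v_inj
  (fun z => vP (i z, 0) (etrans (ses0 sip z) (esym (linear0 q)))).
have [i2 i2P] := @inj_lift Y _ T v (pair_lin (zero_lin T E) j) v_inj
  (fun z => vP (0, j z) (esym (etrans (ses0 sjq z) (esym (linear0 p))))).
exists Y, i1, (comp_lin (snd_lin E Q) v), i2, (comp_lin (fst_lin E Q) v).
have v2 y : comp_lin (snd_lin E Q) v y = (v y).2 by [].
have v1 y : comp_lin (fst_lin E Q) v y = (v y).1 by [].
split; split.
- move=> x y /(congr1 v); rewrite !i1P => -[]; exact: i_inj.
- by move=> u; have [e pe] := p_surj (q u); have [y yP] := vP (e, u) pe;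
    exists y; rewrite v2 yP.
- move=> y; rewrite v2; split=> [y0|[z <-]]; last by rewrite i1P.
  have /ex[z zP] : p (v y).1 = 0 by rewrite vE y0 linear0.
  by exists z; apply: v_inj; rewrite i1P [v y]surjective_pairing -zP y0.
- move=> x y /(congr1 v); rewrite !i2P => -[]; exact: j_inj.
- by move=> e; have [u pu] := q_surj (p e); have [y yP] := vP (e, u) (esym pu);
    exists y; rewrite v1 yP.
- move=> y; rewrite v1; split=> [y0|[z <-]]; last by rewrite i2P.
  have /exq[z zP] : q (v y).2 = 0 by rewrite -vE y0 linear0.
  by exists z; apply: v_inj; rewrite i2P [v y]surjective_pairing -zP y0.
Qed.

(** [E] is the preimage of [X] under [q], realised as the kernel of [p] after [q]. *)
Lemma ses_preimage X Y W P (i : {linear X -> Y}) (p : {linear Y -> W})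
    (Z : lmodType A) (j : {linear Z -> P}) (q : {linear P -> Y}) :
  ses i p -> ses j q ->
  exists (E : lmodType A) (i1 : {linear E -> P}) (i2 : {linear Z -> E})
    (p2 : {linear E -> X}),
    [/\ ses i1 (comp_lin p q), ses i2 p2 & forall z, i1 (i2 z) = j z].
Proof.
move=> sip sjq; have [i_inj p_surj ex] := sip; have [j_inj q_surj exq] := sjq.
have pq_surj w : exists u, comp_lin p q u = w.
  by have [y <-] := p_surj w; have [u <-] := q_surj y; exists u.
have [E [i1 s1]] : exists E (i1 : {linear E -> P}), ses i1 (comp_lin p q).
  by exists (ker_type (comp_lin p q)), (ker_incl _); exact: ker_ses.
have [i1_inj _ ex1] := s1.
have [z|i2 i2P] := @ker_lift _ _ _ _ i1 _ j s1.
  by rewrite /= (ses0 sjq) linear0.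
have [z|p2 p2P] := @ker_lift _ _ _ _ i p (comp_lin q i1) sip.
  exact: (ses0 s1 z).
exists E, i1, i2, p2; split=> //; split=> [x y|x|e].
- by move=> /(congr1 i1); rewrite !i2P => /j_inj.
- have [u uP] := q_surj (i x).
  have /ex1[e eP] : comp_lin p q u = 0 by rewrite /= uP (ses0 sip).
  by exists e; apply: i_inj; rewrite p2P /= eP.
- split=> [e0|[z <-]].
    have /exq[z zP] : q (i1 e) = 0 by rewrite -[LHS]p2P e0 linear0.
    by exists z; apply: i1_inj; rewrite i2P.
  by apply: i_inj; rewrite p2P /= i2P (ses0 sjq) linear0.
Qed.

(** The fibre product of [E] and [Q] over [X] is an extension of [E] by [T], so [mid] applies to it,
    and [Z] is its complement to the projective [Q]. The hypothesis [mid] is kept explicit because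
    [extv_middle] uses this argument inside its own induction. *)
Lemma extv_middle_of n : 
  (forall X Y W (i : {linear X -> Y}) (p : {linear Y -> W}),
    ses i p -> extv n X N -> extv n W N -> extv n Y N) ->
  forall Z E X (i : {linear Z -> E}) (p : {linear E -> X})
    T Q (j : {linear T -> Q}) (q : {linear Q -> X}),
    ses i p -> ses j q -> projective Q ->
    extv n E N -> extv n T N -> extv n Z N.
Proof.
move=> mid Z E X i p T Q j q sip sjq Qp extE extT.
have [Y [i1 [p1 [i2 [p2 [s1 s2]]]]]] := ses_pullback sip sjq.
exact: extv_split Qp s1 (mid _ _ _ _ _ s2 extT extE).
Qed.

(** In degree one, a map is extended first to the preimage of [X] and then to [P]. In higher degrees
    that preimage is a syzygy of [W], and the syzygy [Z] of [Y] is its kernel over [X]. *)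
Lemma extv_middle n X Y W (i : {linear X -> Y}) (p : {linear Y -> W}) :
  ses i p -> extv n X N -> extv n W N -> extv n Y N.
Proof.
elim: n X Y W i p => [|n IH] X Y W i p sip extX extW Z P j q.
  move=> f sjq; have [E [i1 [i2 [p2 [s1 s2 ijE]]]]] := ses_preimage sip sjq.
  have [g gP] := extX _ _ _ _ f s2; have [h hP] := extW _ _ _ _ g s1.
  by exists h => z; rewrite -ijE hP gP.
move=> Pp sjq; have [E [i1 [i2 [p2 [s1 s2 ijE]]]]] := ses_preimage sip sjq.
have [T [Q [k [l [Qp skl]]]]] := projective_presentation X.
exact: extv_middle_of IH _ _ _ _ _ _ _ _ _ s2 skl Qp (extW _ _ _ _ Pp s1)
  (extX _ _ _ _ Qp skl).
Qed.

(** This is exactness of Ext^(n+1)(E,N) -> Ext^(n+1)(Z,N) -> Ext^(n+2)(X,N) at the middle term. *)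
Lemma extv_left n Z E X (i : {linear Z -> E}) (p : {linear E -> X}) :
  ses i p -> extv n E N -> extv n.+1 X N -> extv n Z N.
Proof.
move=> sip extE extX.
have [T [Q [k [l [Qp skl]]]]] := projective_presentation X.
exact: extv_middle_of (@extv_middle n) _ _ _ _ _ _ _ _ _ sip skl Qp extE
  (extX _ _ _ _ Qp skl).
Qed.

(** [extv] quantifies over all projective presentations; a single one decides it. *)
Lemma extv_shift n Z P X (i : {linear Z -> P}) (p : {linear P -> X}) :
  ses i p -> projective P -> extv n.+1 X N <-> extv n Z N.
Proof.
move=> sip Pp; split=> [extX|extZ T Q j q Qp sjq]; first exact: extX Pp sip.
exact: extv_middle_of (@extv_middle n) _ _ _ _ _ _ _ _ _ sjq sip Pp
  (extv_projective n Qp) extZ.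
Qed.

(** The indices are arranged so that [P n] maps onto the [n]-th syzygy and contains the next one. *)
Fixpoint res_syz X (P : proj_resolution X) n : lmodType A :=
  match n with 0 => X | 1 => ker_type (res_aug P) | m.+2 => ker_type (res_d P m) end.

Lemma res_syzP X (P : proj_resolution X) n :
  exists (i : {linear res_syz P n.+1 -> P n}) (p : {linear P n -> res_syz P n})
    (q : {linear P n.+1 -> res_syz P n.+1}),
    [/\ ses i p, forall z, exists y, q y = z & forall y, i (q y) = res_d P n y].
Proof.
have step (U V : lmodType A) (f : {linear U -> V}) Y (g : {linear Y -> U}) :
    (forall x, f x = 0 <-> exists y, g y = x) ->
    exists q : {linear Y -> ker_type f}, (forall z, exists y, q y = z)
      /\ forall y, ker_incl f (q y) = g y.
  move=> ex; have inj : injective (ker_incl f) by exact: val_inj.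
  have [|q qP] := @inj_lift _ _ Y _ g inj.
    by move=> y; apply/ker_inclP/ex; exists y.
  exists q; split=> // z; have /ex[y yP] : f (ker_incl f z) = 0.
    by apply/ker_inclP; exists z.
  by exists y; apply: inj; rewrite qP.
case: n => [|[|n]] /=.
- have [q [q_surj qE]] := step _ _ _ _ _ (@res_exact0 _ _ P).
  exists (ker_incl _), (res_aug P), q; split=> //.
  exact/ker_ses/res_aug_surj.
- have [q [q_surj qE]] := step _ _ _ _ _ (@res_exact _ _ P 0).
  have [p [p_surj pE]] := step _ _ _ _ _ (@res_exact0 _ _ P).
  exists (ker_incl _), p, q; split=> //; split=> [|//|e]; first exact: val_inj.
  rewrite -ker_inclP -pE; split=> [->|]; first by rewrite linear0.
  by rewrite -[X in _ = X -> _](linear0 (ker_incl (res_aug P))) => /val_inj.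
- have [q [q_surj qE]] := step _ _ _ _ _ (@res_exact _ _ P n.+1).
  have [p [p_surj pE]] := step _ _ _ _ _ (@res_exact _ _ P n).
  exists (ker_incl _), p, q; split=> //; split=> [|//|e]; first exact: val_inj.
  rewrite -ker_inclP -pE; split=> [->|]; first by rewrite linear0.
  by rewrite -[X in _ = X -> _](linear0 (ker_incl (res_d P n))) => /val_inj.
Qed.

Lemma extv_res X (P : proj_resolution X) n :
  extv n X N <-> ext1 (res_syz P n) N.
Proof.
have gen m : extv n (res_syz P m) N <-> ext1 (res_syz P (n + m)) N.
  elim: n m => [|n IH] m //.
  have [i [p [_ [sip _ _]]]] := res_syzP P m.
  rewrite addSnnS -IH; exact: extv_shift sip (@res_proj _ _ P m).
by rewrite -[X in res_syz P X]addn0 -gen.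
Qed.

(** A cocycle on [P n.+1] is a map out of the syzygy [res_syz P n.+1] inside [P n], and it is a
    coboundary exactly when that map extends to [P n]. *)
Lemma ext1_res X (P : proj_resolution X) n :
  ext1 (res_syz P n) N <->
  forall f : {linear P n.+1 -> N}, cocycle f -> coboundary f.
Proof.
have [i [p [q [sip q_surj qE]]]] := res_syzP P n.
have [i' [p' [q' [sip' q'_surj qE']]]] := res_syzP P n.+1.
have [i_inj _ _] := sip; split=> [ext f fc|cob].
  have [|g gP] := @ker_factor _ _ _ q f q_surj.
    move=> e e0; have /res_exact[y <-] : res_d P n e = 0.
      by rewrite -qE e0 linear0.
    exact: fc.
  have [h hP] := ext _ _ _ _ g sip.
  by exists h => x; rewrite -qE hP gP.
apply: (ext1_presentation (@res_proj _ _ P n) sip) => f.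
have [|g gP] := cob (comp_lin f q).
  move=> x /=; rewrite (_ : q _ = 0) ?linear0 //; apply: i_inj.
  by rewrite qE linear0; apply/res_exact; exists x.
by exists g => z; have [y <-] := q_surj z; rewrite qE -gP.
Qed.

Lemma Ext_eq0P X n : Ext_eq0 n.+1 X N <-> extv n X N.
Proof.
split=> [ext|ext P]; last exact/ext1_res/extv_res.
by have [P] := exists_resolution X; apply/(extv_res P)/ext1_res/ext.
Qed.

End Ext.
End LinearMaps.

(** * Vector spaces and restriction of scalars *)

Section VectorSpaces.
Variable k : fieldType.
Implicit Types U V W E : lmodType k.

Definition subspace E (S : E -> Prop) : Prop :=
  S 0 /\ forall b x y, S x -> S y -> S (b *: x + y).

(** Zorn's lemma gives a maximal subspace [B] containing [S] on which [p] is injective. Maximality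
    makes [p] map [B] onto [W], and the section is the inverse of this bijection. *)
Lemma section_extension E W (p : {linear E -> W}) (S : E -> Prop) :
  (forall w, exists e, p e = w) -> subspace S ->
  (forall e, S e -> p e = 0 -> e = 0) ->
  exists s : {linear W -> E},
    (forall w, p (s w) = w) /\ forall e, S e -> s (p e) = e.
Proof.
move=> p_surj S_sub S_inj.
pose good (B : set E) := subspace B /\ forall e, B e -> p e = 0 -> e = 0.
(* Taking the union with [S] in the predicate also covers the empty chain, whose union is empty. *)
have [|B' [B_good B_max]] := @Zorn_bigcup E (fun B => good (B `|` S)%classic).
  move=> F F_good F_tot; have [->|/set0P[X0 FX0]] := eqVneq F set0.
    by rewrite bigcup_set0 set0U.
  have inF x y : (\bigcup_(X in F) X `|` S)%classic x ->
      (\bigcup_(X in F) X `|` S)%classic y ->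
      exists X, [/\ F X, (X `|` S)%classic x & (X `|` S)%classic y].
    move=> [[X FX Xx]|Sx] [[Y FY Yy]|Sy].
    - have [XY|YX] := F_tot _ _ FX FY.
        by exists Y; split=> //; left; [exact: XY | ].
      by exists X; split=> //; left; [ | exact: YX].
    - by exists X; split=> //; [left | right].
    - by exists Y; split=> //; [right | left].
    - by exists X0; split=> //; right.
  split; first split; first by right; case: S_sub.
    move=> b x y Ux Uy; have [X [FX Xx Xy]] := inF x y Ux Uy.
    have [[_ XP] _] := F_good _ FX.
    by have [Xb|Sb] := XP b x y Xx Xy; [left; exists X | right].
  move=> e Ue; have [X [FX Xe _]] := inF e e Ue Ue.
  by have [_] := F_good _ FX; apply.
set B := (B' `|` S)%classic in B_good.
have [[B0 BP] B_inj] := B_good; have SB e : S e -> B e by right.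
have B_surj w : exists e, B e /\ p e = w.
  have [e <-] := p_surj w; apply: contrapT => nBe.
  (* If [p e] were not reached from [B], the span of [B] and [e] would still meet the kernel of [p]
     trivially, against maximality. *)
  pose C : set E := fun x => exists b y, B y /\ x = b *: e + y.
  have BC x : B x -> C x by move=> Bx; exists 0, x; rewrite scale0r add0r.
  apply: (B_max C).
    split=> [x Bx|CB]; first by apply: BC; left.
    apply: nBe; exists e; split=> //; left; apply: CB.
    by exists 1, 0; rewrite scale1r addr0.
  have -> : (C `|` S)%classic = C.
    by apply/seteqP; split=> x; [case=> // /SB/BC | left].
  split; first split; first exact: BC.
    move=> d _ _ [b [x [Bx ->]]] [b' [y [By ->]]].
    exists (d * b + b'), (d *: x + y); split; first exact: BP.
    by rewrite scalerDr scalerA scalerDl addrACA.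
  move=> _ [b [y [By ->]]]; have [->|b0] := eqVneq b 0.
    by rewrite scale0r add0r; exact: B_inj.
  rewrite linearP addrC => /eqP; rewrite addr_eq0 => /eqP py.
  case: nBe; exists (- b^-1 *: y + 0); split; first exact: BP.
  by rewrite addr0 linearZ /= py scaleNr scalerN opprK scalerA mulVf // scale1r.
have [s sP] := choice B_surj.
have sE e : B e -> s (p e) = e.
  move=> Be; have [Bs ps] := sP (p e).
  apply/eqP; rewrite -subr_eq0 -scaleN1r addrC; apply/eqP/B_inj; first exact: BP.
  by rewrite linearP ps scaleN1r addNr.
have s_lin : linear s.
  move=> b x y; have [Bx px] := sP x; have [By py] := sP y.
  by rewrite -{1}px -{1}py -linearP sE //; exact: BP.
by exists (mklin s_lin); split=> [w|e /SB/sE //]; have [] := sP w.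
Qed.

(** The rule [h v |-> l v] is a partial section of [W * U -> W], with the pairs [(h v, l v)] as its
    graph; a section extending it yields [m]. *)
Lemma linear_extension U V W (h : {linear V -> W}) (l : {linear V -> U}) :
  (forall v, h v = 0 -> l v = 0) ->
  exists m : {linear W -> U}, forall v, m (h v) = l v.
Proof.
move=> hl.
have [|||s [sP sE]] := @section_extension (W * U)%type W (fst_lin W U)
  (fun e => exists v, e = (h v, l v)).
- by move=> w; exists (w, 0).
- split=> [|b _ _ [x ->] [y ->]]; first by exists 0; rewrite !linear0.
  by exists (b *: x + y); rewrite !linearP.
- by move=> _ [v ->] /= hv; rewrite hv hl.
exists (comp_lin (snd_lin W U) s) => v /=.
by rewrite (sE (h v, l v)) //; exists v.
Qed.

Lemma linear_lift U V W (g : {linear U -> V}) (f : {linear W -> V}) :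
  (forall v, exists u, g u = v) ->
  exists h : {linear W -> U}, forall w, g (h w) = f w.
Proof.
move=> g_surj.
have [||s [sP _]] := @section_extension U V g (fun e => e = 0) g_surj.
- by split=> // b _ _ -> ->; rewrite scaler0 addr0.
- by [].
by exists (comp_lin s f) => w /=; rewrite sP.
Qed.
End VectorSpaces.

(** * Restriction of scalars from [A] to [k] *)

Section RestrictScalars.
Variables (k : fieldType) (A : algType k).

Definition kres (M : lmodType A) : Type := M.

Section Kres.
Variable M : lmodType A.
HB.instance Definition _ := GRing.Zmodule.on (kres M).

Definition kres_scale (b : k) (m : kres M) : kres M := (b%:A : A) *: (m : M).

Fact kres_scaleA b d v : kres_scale b (kres_scale d v) = kres_scale (b * d) v.
Proof. by rewrite /kres_scale scalerA -scalerAl mul1r scalerA. Qed.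
Fact kres_scale1 : left_id 1 kres_scale.
Proof. by move=> v; rewrite /kres_scale !scale1r. Qed.
Fact kres_scaleDr : right_distributive kres_scale +%R.
Proof. by move=> b u v; rewrite /kres_scale scalerDr. Qed.
Fact kres_scaleDl v : {morph kres_scale^~ v : b d / b + d}.
Proof. by move=> b d; rewrite /kres_scale !scalerDl. Qed.

HB.instance Definition _ := GRing.Zmodule_isLmodule.Build k (kres M)
  kres_scaleA kres_scale1 kres_scaleDr kres_scaleDl.

Lemma kresZ (b : k) (m : kres M) : b *: m = (b%:A : A) *: (m : M) :> M.
Proof. by []. Qed.

Lemma kres_mul (b : k) (x : A) (m : kres M) :
  (b *: x) *: (m : M) = b *: (x *: (m : M) : kres M) :> M.
Proof. by rewrite kresZ scalerA -scalerAl mul1r. Qed.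

Lemma kres_mulC (b : k) (x : A) (m : kres M) :
  x *: (b *: m : M) = b *: (x *: (m : M) : kres M) :> M.
Proof. by rewrite !kresZ !scalerA -scalerAl mul1r -scalerAr mulr1. Qed.

Definition kact (x : A) : {linear kres M -> kres M}.
Proof.
refine (@mklin k (kres M) (kres M) (fun m => x *: (m : M)) _).
by move=> b u v; rewrite scalerDr kres_mulC.
Defined.
End Kres.

Definition kmap (M N : lmodType A) (f : {linear M -> N}) :
  {linear kres M -> kres N}.
Proof.
refine (@mklin k (kres M) (kres N) (fun m => f m) _).
by move=> b u v; rewrite linearD /= !kresZ linearZ.
Defined.
End RestrictScalars.

Section QuotAlg.
Local Open Scope quotient_scope.
Variables (k : comNzRingType) (R : algType k) (S : R -> Prop).
Hypothesis proper : ~ ideal_gen S 1.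
Notation Q := (quot_alg proper).

Lemma quot_alg_eq (x y : R) : ideal_gen S (x - y) -> \pi_Q x = \pi_Q y.
Proof. by move=> ?; apply/eqP/quot_algP. Qed.

Fact quot_alg_repr (x : R) : ideal_gen S (repr (\pi_Q x) - x).
Proof. by apply/quot_algP; rewrite reprK. Qed.

Lemma quot_algD (x y : R) : \pi_Q (x + y) = \pi_Q x + \pi_Q y.
Proof.
symmetry; apply: quot_alg_eq; rewrite opprD addrACA.
by apply: ideal_genD; exact: quot_alg_repr.
Qed.

Lemma quot_algM (x y : R) : \pi_Q (x * y) = \pi_Q x * \pi_Q y.
Proof.
symmetry; apply: quot_alg_eq; set x' := repr _; set y' := repr _.
rewrite -(subrKA (x' * y)) -mulrBr -mulrBl.
by apply: ideal_genD; [apply: ideal_genMl | apply: ideal_genMr];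
  exact: quot_alg_repr.
Qed.

Lemma quot_algZ (b : k) (x : R) : \pi_Q (b *: x) = b *: \pi_Q x.
Proof.
symmetry; apply: quot_alg_eq; rewrite -scalerBr -mulr_algl.
by apply: ideal_genMl; exact: quot_alg_repr.
Qed.

End QuotAlg.

(** * Modules over the quantum complete intersection *)

Lemma malgUZ (R : nzRingType) (K : choiceType) (b : R) (w : K) :
  << b *g w >> = b *: (<< w >> : {malg R[K]}).
Proof. by apply/malgP => u; rewrite mcoeffZ !mcoeffU mulrnAr mulr1. Qed.

Section QuotModule.
Local Open Scope quotient_scope.
Variables (k : fieldType) (R : algType k) (S : R -> Prop).
Hypothesis proper : ~ ideal_gen S 1.
Notation Q := (quot_alg proper).
Variables (V : lmodType k) (act : R -> V -> V).
Hypothesis act_linl : forall b x y v, act (b *: x + y) v = b *: act x v + act y v.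
Hypothesis act_linr : forall x, linear (act x).
Hypothesis act1 : forall v, act 1 v = v.
Hypothesis actM : forall x y v, act (x * y) v = act x (act y v).
Hypothesis actS : forall x, S x -> forall v, act x v = 0.

Let act0 v : act 0 v = 0.
Proof. by rewrite -[0 in LHS](addNr (1 : R)) -scaleN1r act_linl scaleN1r addNr. Qed.

Lemma act_ideal x : ideal_gen S x -> forall v, act x v = 0.
Proof.
elim=> {x} [x /actS //|v|x y _ IHx _ IHy v|u x w _ IH v].
- exact: act0.
- by rewrite -[x]scale1r act_linl IHx IHy scaler0 addr0.
- by rewrite !actM IH; exact: linear0 (mklin (act_linr u)).
Qed.

(** The vanishing proof is a parameter of the type, so that the [Q]-module structure attached to it
    can refer to that proof. *)
Definition quot_module of (forall x, S x -> forall v, act x v = 0) : Type := V.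
Let O := quot_module actS.

HB.instance Definition _ := GRing.Zmodule.on O.

Definition quot_act (x : Q) (v : O) : O := act (repr x) v.

Lemma quot_actE x v : quot_act (\pi_Q x) v = act x v.
Proof.
apply/eqP; rewrite -subr_eq0 addrC -scaleN1r -act_linl scaleN1r addrC.
exact/eqP/act_ideal/quot_alg_repr.
Qed.

Let piS (P : Q -> Prop) : (forall x, P (\pi_Q x)) -> forall x, P x.
Proof. by move=> Ppi x; rewrite -[x]reprK. Qed.

Fact quot_actA x y v : quot_act x (quot_act y v) = quot_act (x * y) v.
Proof.
elim/piS: x => x; elim/piS: y => y.
by rewrite -quot_algM !quot_actE actM.
Qed.
Fact quot_act1 : left_id 1 quot_act.
Proof. by move=> v; rewrite -[1]/(\pi_Q 1) quot_actE act1. Qed.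
Fact quot_actDr : right_distributive quot_act +%R.
Proof.
move=> x u v; elim/piS: x => x; rewrite !quot_actE.
by have := act_linr x 1 u v; rewrite !scale1r.
Qed.
Fact quot_actDl v : {morph quot_act^~ v : x y / x + y}.
Proof.
move=> x y; elim/piS: x => x; elim/piS: y => y.
by rewrite -quot_algD !quot_actE -[x in LHS]scale1r act_linl scale1r.
Qed.

HB.instance Definition _ := GRing.Zmodule_isLmodule.Build Q O
  quot_actA quot_act1 quot_actDr quot_actDl.

(* The carrier of the module is V itself; the identity of V is stated as a
   k-linear bijection so that later arguments do not depend on the carrier. *)
Lemma quot_module_ex : exists (M : lmodType Q)
    (t : {linear V -> kres M}) (u : {linear kres M -> V}),
  [/\ cancel t u, cancel u t
    & forall x v, t (act x v) = \pi_Q x *: (t v : M)].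
Proof.
have t_lin : linear (fun v : V => v : kres O).
  move=> b u v; congr (_ + _); rewrite kresZ -[1]/(\pi_Q 1) -quot_algZ.
  change (b *: u = quot_act (\pi_Q (b *: 1)) u).
  by rewrite quot_actE -[b *: 1]addr0 act_linl act1 act0 addr0.
have u_lin : linear (fun v : kres O => v : V).
  by move=> b u v; rewrite (t_lin b u v).
exists O, (mklin t_lin), (mklin u_lin); split=> // x v.
by change (act x v = quot_act (\pi_Q x) v); rewrite quot_actE.
Qed.

End QuotModule.

Section QciModules.
Local Open Scope quotient_scope.
Variables (k : fieldType) (c : nat) (q : 'M[k]_c) (a : 'I_c -> nat).
Hypothesis a_ge2 : forall i, (2 <= a i)%N.

Notation A := (qci q a_ge2).
Notation FA := (free_alg k c).

Definition qpi (x : FA) : A := \pi_(quot_alg (qci_proper a_ge2)) x.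

Lemma qpiD x y : qpi (x + y) = qpi x + qpi y.
Proof. exact: quot_algD. Qed.
Lemma qpiM x y : qpi (x * y) = qpi x * qpi y.
Proof. exact: quot_algM. Qed.
Lemma qpiZ b x : qpi (b *: x) = b *: qpi x.
Proof. exact: quot_algZ. Qed.
Lemma qpi1 : qpi 1 = 1. Proof. by []. Qed.
Lemma qpi0 : qpi 0 = 0. Proof. by []. Qed.
Lemma qpi_eq x y : ideal_gen (qci_rel q a) (x - y) -> qpi x = qpi y.
Proof. exact: quot_alg_eq. Qed.
Lemma qpi_surj x : exists y, qpi y = x.
Proof. by exists (repr (x : quot_alg (qci_proper a_ge2))); exact: reprK. Qed.
Lemma qpiX x n : qpi (x ^+ n) = qpi x ^+ n.
Proof. by elim: n => [|n IH]; rewrite ?expr0 // !exprS qpiM IH. Qed.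

Definition qX (i : 'I_c) : A := qpi (gen k i).

Lemma qX_pow i : qX i ^+ a i = 0.
Proof.
rewrite -qpiX -qpi0; apply: qpi_eq; rewrite subr0.
by apply: ideal_gen_base; exact: qci_rel_pow.
Qed.

Lemma qX_com i j : qX i * qX j = q i j *: (qX j * qX i).
Proof.
rewrite -!qpiM -qpiZ; apply: qpi_eq.
by apply: ideal_gen_base; exact: qci_rel_com.
Qed.

Lemma mkmalgUM (u v : {fmonom 'I_c}) : (<< u >> : FA) * << v >> = << mmul u v >>.
Proof. by rewrite [LHS]malgM_def fgmulUU mulr1. Qed.

Lemma free_alg_span (P : FA -> Prop) :
  P 0 -> (forall w, P << w >>) ->
  (forall b x y, P x -> P y -> P (b *: x + y)) -> forall x, P x.
Proof.
move=> P0 PU PD x; rewrite (monalgE x); elim/big_rec: _ => // w y _ Py.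
by rewrite malgUZ; exact: (PD _ _ _ (PU w) Py).
Qed.

Lemma free_alg_ind (P : FA -> Prop) :
  P 1 -> (forall i x, P x -> P (gen k i * x)) ->
  (forall b x y, P x -> P y -> P (b *: x + y)) -> forall x, P x.
Proof.
move=> P1 PX PD; apply: (free_alg_span _ _ PD) => [|w].
  by have := PD (- 1) 1 1 P1 P1; rewrite scaleN1r addNr.
rewrite -[w]fmK; elim: (w : seq _) => [|i s IH].
  by rewrite -fmoneE.
have -> : (<< FMonom (i :: s) >> : FA) = gen k i * << FMonom s >>.
  rewrite mkmalgUM; congr << _ >>.
  by apply/eqP; rewrite fmP fmM fmU.
exact: PX.
Qed.

Lemma qci_ind (P : A -> Prop) :
  P 1 -> (forall i x, P x -> P (qX i * x)) ->
  (forall b x y, P x -> P y -> P (b *: x + y)) -> forall x, P x.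
Proof.
move=> P1 PX PD x; have [y <-] := qpi_surj x.
elim/free_alg_ind: y => [|i y Py|b y z Py Pz].
- by rewrite qpi1.
- by rewrite qpiM; exact: PX.
- by rewrite qpiD qpiZ; exact: PD.
Qed.

(** These are the relations among the variables in [s] only: [V] becomes a module over the quantum
    complete intersection on [s], and the operators outside [s] are unconstrained. *)
Definition qrel (s : seq 'I_c) (V : lmodType k) (T : 'I_c -> {linear V -> V}) :=
  (forall i, i \in s -> forall v, iter (a i) (T i) v = 0) /\
  (forall i j, i \in s -> j \in s -> forall v, T i (T j v) = q i j *: T j (T i v)).

Section OperatorModule.
Variables (V : lmodType k) (T : 'I_c -> {linear V -> V}).

Definition word_act (v : V) (w : {fmonom 'I_c}) : V :=
  foldr (fun i => T i) v (w : seq 'I_c).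

Definition free_act (x : FA) (v : V) : V := free_lift (word_act v) x.

Let free_actP b x y v :
  free_act (b *: x + y) v = b *: free_act x v + free_act y v.
Proof. exact: (linearP (free_lift (word_act v))). Qed.
Let free_act0 v : free_act 0 v = 0.
Proof. exact: (linear0 (free_lift (word_act v))). Qed.
Let free_act1 v : free_act 1 v = v.
Proof. by rewrite /free_act -[1]/(<< mone >>) free_liftU /word_act fm1. Qed.

Let free_act_linear x : linear (free_act x).
Proof.
move=> b u v; rewrite /free_act /= /free_lift_fun scaler_sumr -big_split /=.
apply: eq_bigr => w _; rewrite scalerA mulrC -scalerA -scalerDr; congr (_ *: _).
by rewrite /word_act; elim: (w : seq _) => //= i s ->; rewrite linearP.
Qed.

Let free_act_gen i x v : free_act (gen k i * x) v = T i (free_act x v).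
Proof.
elim/free_alg_span: x => [|w|b x y IHx IHy].
- by rewrite mulr0 free_act0 linear0.
- by rewrite mkmalgUM /free_act !free_liftU /word_act fmM fmU.
- rewrite mulrDr -scalerAr.
  apply: (etrans (free_actP b (gen k i * x) (gen k i * y) v)).
  apply: (etrans (congr2 (fun u w => b *: u + w) IHx IHy)).
  apply: (esym (etrans (congr1 (T i) (free_actP b x y v)) _)).
  exact: linearP.
Qed.

Let free_actM x y v : free_act (x * y) v = free_act x (free_act y v).
Proof.
elim/free_alg_ind: x => [|i x IH|b x z IHx IHz].
- by rewrite mul1r free_act1.
- rewrite -mulrA; apply: (etrans (free_act_gen i (x * y) v)).
  exact: (etrans (congr1 (T i) IH) (esym (free_act_gen i x _))).
- rewrite mulrDl -scalerAl; apply: (etrans (free_actP b (x * y) (z * y) v)).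
  apply: (etrans (congr2 (fun u w => b *: u + w) IHx IHz)).
  exact: (esym (free_actP b x z _)).
Qed.

(** Words in the [T i] make [V] a module over the free algebra, and [qrel] says that the defining
    relations act as zero, so the action descends. *)
Lemma operator_module : qrel (enum 'I_c) T -> exists (M : lmodType A)
    (t : {linear V -> kres M}) (u : {linear kres M -> V}),
  [/\ cancel t u, cancel u t & forall i v, t (T i v) = qX i *: (t v : M)].
Proof.
move=> T_rel; have gen1 i v : free_act (gen k i) v = T i v.
  by rewrite -[gen k i]mulr1 free_act_gen free_act1.
have act_pow i n v : free_act (gen k i ^+ n) v = iter n (T i) v.
  elim: n => [|n IH]; first by rewrite expr0 free_act1.
  by rewrite exprS free_act_gen IH.
have act_rel x : qci_rel q a x -> forall v, free_act x v = 0.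
  case=> {x} [i|i j] v; first by rewrite act_pow T_rel.1 ?mem_enum.
  have gen2 i' j' : free_act (gen k i' * gen k j') v = T i' (T j' v).
    by rewrite free_act_gen gen1.
  rewrite -scaleNr addrC.
  apply: (etrans (free_actP (- q i j) (gen k j * gen k i) (gen k i * gen k j) v)).
  apply: (etrans (congr2 (fun u w => - q i j *: u + w) (gen2 j i) (gen2 i j))).
  by rewrite (T_rel.2 i j) ?mem_enum // scaleNr addNr.
have [M [t [u [tu ut tE]]]] := quot_module_ex (qci_proper a_ge2) free_actP
  free_act_linear free_act1 free_actM act_rel.
by exists M, t, u; split=> // i v; rewrite -gen1 tE.
Qed.

End OperatorModule.
End QciModules.

(** * Periodicity *)

Lemma sum_shift (V : nmodType) n (H : nat -> V) : (0 < n)%N -> H n.-1 = 0 ->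
  \sum_(e < n) (if e : nat is p.+1 then H p else 0) = \sum_(e < n) H e.
Proof.
by case: n => // n _ Hn; rewrite big_ord_recl big_ord_recr /= Hn add0r addr0.
Qed.

(** * Truncated polynomials with coefficients in a vector space *)

Section FiniteSequences.
Variables (k : fieldType) (n : nat) (V : lmodType k).
Notation F := {ffun 'I_n -> V}.

(* Entries beyond the length n are 0. *)
Definition entry (f : F) (t : nat) : V := if insub t is Some o then f o else 0.

Lemma entry_ord (f : F) (t : 'I_n) : entry f t = f t.
Proof. by rewrite /entry valK. Qed.

Lemma entry_out (f : F) t : (n <= t)%N -> entry f t = 0.
Proof. by move=> nt; rewrite /entry insubF // ltnNge nt. Qed.

Lemma entry_ffun (G : nat -> V) t :
  entry [ffun s : 'I_n => G s] t = if (t < n)%N then G t else 0.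
Proof.
have [tn|nt] := ltnP; last by rewrite entry_out.
by rewrite -[t]/(val (Ordinal tn)) entry_ord ffunE.
Qed.

Lemma entryP (f g : F) : (forall t, (t < n)%N -> entry f t = entry g t) -> f = g.
Proof. by move=> fg; apply/ffunP => t; rewrite -!entry_ord fg. Qed.

Lemma entry_linear t : linear (entry^~ t).
Proof.
move=> b f g; have [tn|nt] := ltnP t n; last by rewrite !entry_out // scaler0 addr0.
by rewrite -[t]/(val (Ordinal tn)) !entry_ord !ffunE.
Qed.

Definition entry_lin t : {linear F -> V} := mklin (entry_linear t).

Lemma entry0 t : entry 0 t = 0. Proof. exact: (linear0 (entry_lin t)). Qed.
Lemma entryZ b f t : entry (b *: f) t = b *: entry f t.
Proof. exact: (linearZ_LR (entry_lin t)). Qed.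

Lemma entryB f g t : entry (f - g) t = entry f t - entry g t.
Proof. exact: (linearB (entry_lin t)). Qed.

Lemma entry_lin_ext (U : lmodType k) (G : nat -> {linear U -> V}) :
  linear (fun u => [ffun t : 'I_n => G t u]).
Proof. by move=> b x y; apply/ffunP => t; rewrite !ffunE linearP. Qed.

Definition seq_lin (U : lmodType k) (G : nat -> {linear U -> V}) : {linear U -> F} :=
  mklin (entry_lin_ext G).

Lemma entry_seq_lin (U : lmodType k) (G : nat -> {linear U -> V}) u t :
  entry (seq_lin G u) t = if (t < n)%N then G t u else 0.
Proof. exact: (entry_ffun (fun t => G t u)). Qed.

Definition shift_lin : {linear F -> F} :=
  seq_lin (fun t => if t is s.+1 then entry_lin s else zero_lin F V).

Definition diag_lin (D : nat -> {linear V -> V}) : {linear F -> F} :=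
  seq_lin (fun t => comp_lin (D t) (entry_lin t)).

Lemma entry_shift f t :
  entry (shift_lin f) t =
    if (t < n)%N then if t is s.+1 then entry f s else 0 else 0.
Proof. by rewrite entry_seq_lin; case: t. Qed.

Lemma entry_diag D f t : entry (diag_lin D f) t = D t (entry f t).
Proof.
by rewrite entry_seq_lin; case: ltnP => // nt; rewrite entry_out ?linear0.
Qed.

Lemma entry_iter_shift m f t : entry (iter m shift_lin f) t =
  if (m <= t < n)%N then entry f (t - m) else 0.
Proof.
elim: m t => [|m IH] t.
  by rewrite subn0 /=; case: ltnP => // nt; rewrite entry_out.
rewrite [iter _ _ _]/= entry_shift; case: t => [|t]; first by rewrite if_same.
rewrite IH ltnS subSS; case: (ltnP t.+1 n) => tn; rewrite ?andbF // andbT.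
by rewrite (ltnW tn) andbT.
Qed.

Lemma entry_iter_diag m D f t :
  entry (iter m (diag_lin D) f) t = iter m (D t) (entry f t).
Proof. by elim: m => //= m IH; rewrite entry_diag IH. Qed.

Lemma shift_nilpotent f : iter n shift_lin f = 0.
Proof.
apply: entryP => t tn.
by rewrite entry_iter_shift leqNgt tn /= entry0.
Qed.

Definition unit_seq : {linear V -> F} :=
  seq_lin (fun t => if t is 0 then id_lin V else zero_lin V V).

Lemma entry_unit v t : entry (unit_seq v) t = if (t == 0) && (0 < n)%N then v else 0.
Proof. by rewrite entry_seq_lin; case: t => [|t]; case: ltnP. Qed.

(** With [x] acting as the shift, [F] is V[x]/(x^n); this is the expansion of a polynomial in powers
    of [x]. *)
Lemma shift_expansion (f : F) : f = \sum_(t < n) iter t shift_lin (unit_seq (f t)).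
Proof.
apply: entryP => s sn; rewrite -[entry _ s in RHS]/(entry_lin s _) linear_sum /=.
rewrite (bigD1 (Ordinal sn)) //= entry_iter_shift leqnn sn /= subnn entry_unit.
rewrite (leq_trans _ sn) //= big1 ?addr0; first by rewrite -entry_ord.
move=> t; rewrite -val_eqE /= => ts; rewrite entry_iter_shift entry_unit.
case: (leqP t s) => // t_le; rewrite subn_eq0 (_ : (s <= t)%N = false) ?if_same //.
by apply/negbTE; rewrite -ltnNge ltn_neqAle ts.
Qed.

End FiniteSequences.

(** * Relative projectivity over subalgebras generated by some of the variables *)

Section Periodicity.
Variables (k : fieldType) (c : nat) (q : 'M[k]_c) (a : 'I_c -> nat).
Hypothesis a_ge2 : forall i, (2 <= a i)%N.
Hypothesis q_comm : commutation_matrix q.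
Variables (A : algType k) (X : 'I_c -> A).
Hypothesis Xpow : forall i, X i ^+ a i = 0.
Hypothesis Xcom : forall i j, X i * X j = q i j *: (X j * X i).
Hypothesis Xind : forall P : A -> Prop,
  P 1 -> (forall i x, P x -> P (X i * x)) ->
  (forall b x y, P x -> P y -> P (b *: x + y)) -> forall x, P x.
Hypothesis Xmod : forall (V : lmodType k) (T : 'I_c -> {linear V -> V}),
  qrel q a (enum 'I_c) T -> exists (M : lmodType A)
    (t : {linear V -> kres M}) (u : {linear kres M -> V}),
  [/\ cancel t u, cancel u t & forall i v, t (T i v) = X i *: (t v : M)].

Lemma q_neq0 i j : q i j != 0.
Proof.
by apply/eqP => q0; have /eqP := q_comm.2 i j; rewrite q0 mul0r eq_sym oner_eq0.
Qed.

Lemma gen_linear (M N : lmodType A) (f : {linear kres M -> kres N}) :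
  (forall i (m : M), f (X i *: m) = X i *: (f m : N)) ->
  exists g : {linear M -> N}, forall m, g m = f m.
Proof.
move=> fX; have fA (x : A) (m : M) : f (x *: m) = x *: (f m : N).
  elim/Xind: x m => [|i x IH|b x y IHx IHy] m.
  - by rewrite !scale1r.
  - by rewrite -!scalerA fX IH.
  - by rewrite !scalerDl linearD /= !kres_mul linearZ /= IHx IHy.
have f_lin : linear (f : M -> N).
  by move=> b x y; rewrite -fA; exact: (linearD f).
by exists (mklin f_lin).
Qed.

Lemma kact_iter (M : lmodType A) (x : A) n (m : M) :
  iter n (kact M x) m = x ^+ n *: m.
Proof.
by elim: n => [|n IH]; rewrite ?expr0 ?scale1r // exprS -scalerA -IH.
Qed.

Lemma kmap_act (M N : lmodType A) (f : {linear M -> N}) x m :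
  kmap f (kact M x m) = kact N x (kmap f m).
Proof. by rewrite /= linearZ. Qed.

Lemma kact_com (M : lmodType A) i j (m : M) :
  X i *: (X j *: m) = q i j *: (X j *: (X i *: m) : kres M) :> M.
Proof. by rewrite !scalerA Xcom kres_mul. Qed.

Lemma kact_rel s (M : lmodType A) : qrel q a s (fun i => kact M (X i)).
Proof.
split=> [i _ v|i j _ _ v]; first by rewrite kact_iter Xpow scale0r.
exact: kact_com.
Qed.

Lemma iter_linear (R : nzRingType) (V : lmodType R) (T : {linear V -> V}) n :
  linear (iter n T).
Proof. by elim: n => [//|n IH] b x y /=; rewrite IH linearP. Qed.

Lemma iterZ (R : nzRingType) (V : lmodType R) (T : {linear V -> V}) n b v :
  iter n T (b *: v) = b *: iter n T v.
Proof. exact: (linearZ_LR (mklin (iter_linear T n))). Qed.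

Lemma iter_com s (V : lmodType k) (T : 'I_c -> {linear V -> V}) i j n v :
  qrel q a s T -> i \in s -> j \in s ->
  T i (iter n (T j) v) = q i j ^+ n *: iter n (T j) (T i v).
Proof.
move=> [_ com] si sj; elim: n => [|n IH] /=; first by rewrite expr0 scale1r.
by rewrite com // IH linearZ /= scalerA -exprS.
Qed.

Lemma kact_iter_com (M : lmodType A) l j e (m : M) : X l *: (X j ^+ e *: m) =
  q l j ^+ e *: (X j ^+ e *: (X l *: m) : kres M) :> M.
Proof.
have := @iter_com (enum 'I_c) (kres M) _ l j e m (kact_rel _ M).
by rewrite !mem_enum !kact_iter => ->.
Qed.

Definition scale_lin (V : lmodType k) (b : k) (T : {linear V -> V}) :
  {linear V -> V}.
Proof.
refine (@mklin k V V (fun v => b *: T v) _) => d x y.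
by rewrite linearP scalerDr !scalerA mulrC.
Defined.

Lemma scale_linE (V : lmodType k) b (T : {linear V -> V}) v :
  scale_lin b T v = b *: T v.
Proof. by []. Qed.

Lemma qrel_scale s (V : lmodType k) (T : 'I_c -> {linear V -> V}) (r : 'I_c -> k) :
  qrel q a s T -> qrel q a s (fun i => scale_lin (r i) (T i)).
Proof.
move=> [Tpow Tcom]; split=> [i si v|i j si sj v]; last first.
  by rewrite /= !linearZ /= Tcom // !scalerA; congr (_ *: _);
    rewrite mulrAC mulrC mulrA.
have -> n : iter n (scale_lin (r i) (T i)) v = r i ^+ n *: iter n (T i) v.
  elim: n => [|n IH] /=; first by rewrite expr0 scale1r.
  by rewrite IH linearZ /= scalerA exprS.
by rewrite Tpow // scaler0.
Qed.

(* M is projective as a module over the subalgebra generated by the X_i, i in s. *)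
Definition Sproj (s : seq 'I_c) (M : lmodType A) : Prop :=
  forall (U V : lmodType k) (TU : 'I_c -> {linear U -> U})
    (TV : 'I_c -> {linear V -> V}) (g : {linear U -> V})
    (f : {linear kres M -> V}),
  qrel q a s TU -> (forall v, exists u, g u = v) ->
  (forall i, i \in s -> forall u, g (TU i u) = TV i (g u)) ->
  (forall i, i \in s -> forall m : M, f (X i *: m) = TV i (f m)) ->
  exists h : {linear kres M -> U}, (forall m, g (h m) = f m) /\
    (forall i, i \in s -> forall m : M, h (X i *: m) = TU i (h m)).

Lemma Sproj_nil M : Sproj [::] M.
Proof.
move=> U V TU TV g f _ g_surj _ _.
by have [h hP] := linear_lift f g_surj; exists h.
Qed.

Lemma Sproj_full s M : (forall i, i \in s) -> Sproj s M -> projective M.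
Proof.
move=> s_full Mp U V g f g_surj.
have [||h [hP hX]] := Mp _ _ _ (fun i => kact V (X i)) (kmap g) (kmap f)
  (kact_rel s U) g_surj.
- by move=> i _ u; exact: kmap_act.
- by move=> i _ u; exact: kmap_act.
have [h' h'P] := @gen_linear M U h (fun i m => hX i (s_full i) m).
by exists h' => m; rewrite h'P hP.
Qed.

Lemma Sproj_retract s (P Q : lmodType A) (i : {linear Q -> P})
    (r : {linear P -> Q}) :
  (forall x, r (i x) = x) -> Sproj s P -> Sproj s Q.
Proof.
move=> ri Pp U V TU TV g f relU g_surj gT fT.
have [|h [hP hX]] := Pp _ _ TU TV g (comp_lin f (kmap r)) relU g_surj gT.
  by move=> j sj m /=; rewrite linearZ fT.
exists (comp_lin h (kmap i)); split=> [m|j sj m] /=; first by rewrite hP /= ri.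
by rewrite linearZ hX.
Qed.

(** Projectivity of [P] over the subalgebra splits [p] linearly over that subalgebra, so [K] is a
    retract of [Q] there, though not necessarily over [A]. *)
Lemma Sproj_kernel s (K Q P : lmodType A)
    (i : {linear K -> Q}) (p : {linear Q -> P}) :
  ses i p -> Sproj s Q -> Sproj s P -> Sproj s K.
Proof.
move=> sip Qp Pp; have [i_inj p_surj ex] := sip.
have [||t [tP tX]] := Pp _ _ _ (fun j => kact P (X j)) (kmap p)
  (id_lin (kres P)) (kact_rel s Q) p_surj.
- by move=> j _ u; exact: kmap_act.
- by [].
have [|r rP] := @inj_lift _ (kres K) (kres Q) (kres Q) (kmap i)
   (sub_lin (id_lin (kres Q)) (comp_lin t (kmap p))) i_inj.
  by move=> y; apply/ex; rewrite /= linearB (tP (p y)) subrr.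
have rX j (m : Q) : j \in s -> r (X j *: m) = X j *: (r m : K).
  move=> sj; apply: i_inj; rewrite linearZ.
  have /= -> := rP (X j *: m); have /= -> := rP m.
  by rewrite linearZ /= (tX j sj (p m)) [RHS]scalerBr.
have ri (z : K) : r (i z) = z.
  by apply: i_inj; have /= -> := rP (i z); rewrite (ses0 sip) linear0 subr0.
move=> U V TU TV g f relU g_surj gT fT.
have [|h [hP hX]] := Qp _ _ TU TV g (comp_lin f r) relU g_surj gT.
  by move=> j sj m /=; rewrite rX // fT.
exists (comp_lin h (kmap i)); split=> [m|j sj m] /=; first by rewrite hP /= ri.
by rewrite linearZ hX.
Qed.

Lemma Sproj_pair s (P Q : lmodType A) :
  Sproj s P -> Sproj s Q -> Sproj s (P * Q)%type.
Proof.
move=> Pp Qp U V TU TV g f relU g_surj gT fT.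
have [|h1 [h1P h1X]] := Pp _ _ TU TV g
  (comp_lin f (kmap (pair_lin (id_lin P) (zero_lin P Q)))) relU g_surj gT.
  move=> i si m; rewrite -[RHS](fT i si (m, 0)) /=; congr (f _).
  by rewrite /GRing.scale /= /scale_pair /= scaler0.
have [|h2 [h2P h2X]] := Qp _ _ TU TV g
  (comp_lin f (kmap (pair_lin (zero_lin Q P) (id_lin Q)))) relU g_surj gT.
  move=> i si m; rewrite -[RHS](fT i si (0, m)) /=; congr (f _).
  by rewrite /GRing.scale /= /scale_pair /= scaler0.
exists (comp_lin h1 (kmap (fst_lin P Q)) \+ comp_lin h2 (kmap (snd_lin P Q))).
split=> [[x y]|i si [x y]] /=.
  rewrite linearD h1P h2P /= -linearD; congr (f _).
  by rewrite /GRing.add /= /add_pair /= addr0 add0r.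
by rewrite h1X // h2X // linearD.
Qed.

(** Dividing the operators on [U] and [V] by [r i] preserves the relations and absorbs the scalars.
    This is the lifting property needed for twists. *)
Lemma Sproj_scaled s (M : lmodType A) (r : 'I_c -> k) :
  (forall i, r i != 0) -> Sproj s M ->
  forall (U V : lmodType k) (TU : 'I_c -> {linear U -> U})
    (TV : 'I_c -> {linear V -> V}) (g : {linear U -> V})
    (f : {linear kres M -> V}),
  qrel q a s TU -> (forall v, exists u, g u = v) ->
  (forall i, i \in s -> forall u, g (TU i u) = TV i (g u)) ->
  (forall i, i \in s -> forall m : M,
      r i *: f (X i *: m) = TV i (f m)) ->
  exists h : {linear kres M -> U}, (forall m, g (h m) = f m) /\
    (forall i, i \in s -> forall m : M, r i *: h (X i *: m) = TU i (h m)).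
Proof.
move=> r0 Mp U V TU TV g f relU g_surj gT fT.
have [||h [hP hX]] := Mp _ _ _ (fun i => scale_lin (r i)^-1 (TV i)) g f
  (qrel_scale (fun i => (r i)^-1) relU) g_surj.
- by move=> i si u; rewrite !scale_linE linearZ /= gT.
- by move=> i si m; rewrite scale_linE -fT // scalerA mulVf ?scale1r.
exists h; split=> // i si m.
by rewrite hX // scale_linE scalerA mulfV ?scale1r.
Qed.

(* M' is the twist of M by the automorphism X_i |-> r_i X_i. *)
Definition twist (r : 'I_c -> k) (M M' : lmodType A) : Prop :=
  exists (t : {linear kres M' -> kres M}) (u : {linear kres M -> kres M'}),
  [/\ cancel t u, cancel u t
    & forall i (m : M'), t (X i *: m) = r i *: (X i *: (t m : M) : kres M)].

Lemma twist_ex r M : exists M', twist r M M'.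
Proof.
have [|M' [t [u [tu ut tE]]]] :=
  @Xmod (kres M) (fun i => scale_lin (r i) (kact M (X i))).
  exact/qrel_scale/kact_rel.
exists M', u, t; split=> // i m; apply: (can_inj tu).
by rewrite ut -{1}[m]ut -tE.
Qed.

Lemma twist_div r r' M M1 M2 : (forall i, r i != 0) ->
  twist r M M1 -> twist (fun i => r i * r' i) M M2 -> twist r' M1 M2.
Proof.
move=> r0 [t1 [u1 [tu1 ut1 E1]]] [t2 [u2 [tu2 ut2 E2]]].
exists (comp_lin u1 t2), (comp_lin u2 t1).
split=> [x|x|i m] /=; rewrite ?ut1 ?tu2 ?ut2 ?tu1 //.
apply: (can_inj tu1); rewrite ut1 E2 linearZ /= E1 ut1 scalerA.
by rewrite mulrC.
Qed.

Lemma Sproj_twist s r M M' : (forall i, r i != 0) -> twist r M M' ->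
  Sproj s M -> Sproj s M'.
Proof.
move=> r0 [t [u [tu ut tE]]] Mp U V TU TV g f relU g_surj gT fT.
have uE i (m : M) : r i *: u (X i *: m) = X i *: (u m : M') :> kres M'.
  by apply: (can_inj tu); rewrite linearZ ut tE ut.
have [|h [hP hX]] := Sproj_scaled r0 Mp (f := comp_lin f u) relU g_surj gT.
  by move=> i si m; rewrite /= -linearZ uE fT.
exists (comp_lin h t); split=> [m|i si m] /=; first by rewrite hP /= tu.
by rewrite tE linearZ /= hX.
Qed.

(** * Twisted modules induced from the subalgebra without [X_i] *)

Section Induction.
Variables (i : 'I_c) (r : 'I_c -> k) (M : lmodType A).
Hypothesis r_neq0 : forall l, r l != 0.
Notation F := {ffun 'I_(a i) -> kres M}.

(* The module A (x)_B M, for B generated by the X_l with l != i, twisted by r: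
   f stands for the sum of the X_i^t (x) f t. *)
Definition indT (l : 'I_c) : {linear F -> F} :=
  if l == i then shift_lin (a i) (kres M)
  else diag_lin (a i) (fun t => scale_lin (r l * q l i ^+ t) (kact M (X l))).

Lemma indT_eq : indT i = shift_lin (a i) (kres M).
Proof. by rewrite /indT eqxx. Qed.

Lemma entry_indT l f t : l != i ->
  entry (indT l f) t = (r l * q l i ^+ t) *: (X l *: (entry f t : M) : kres M).
Proof. by move=> li; rewrite /indT (negPf li) entry_diag. Qed.

Lemma indT_com l f : l != i -> indT l (indT i f) = q l i *: indT i (indT l f).
Proof.
move=> li; apply: entryP => t tn; rewrite entry_indT //.
rewrite entryZ indT_eq !entry_shift tn.
case: t tn => [|t] tn; first by rewrite !scaler0.
by rewrite entry_indT // scalerA exprS mulrCA.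
Qed.

Lemma indT_rel s : qrel q a s indT.
Proof.
split=> [l _ f|l m _ _ f].
  have [->|li] := eqVneq l i; first by rewrite indT_eq shift_nilpotent.
  apply: entryP => t tn; rewrite /indT (negPf li) entry_iter_diag.
  have [-> //] := qrel_scale (fun l => r l * q l i ^+ t) (kact_rel [:: l] M).
    by rewrite entry0.
  exact: mem_head.
have [->|li] := eqVneq l i; have [->|mi] := eqVneq m i.
- by rewrite q_comm.1 scale1r.
- by rewrite indT_com // scalerA q_comm.2 scale1r.
- exact: indT_com.
apply: entryP => t tn; rewrite entryZ.
rewrite !entry_indT // !kres_mulC kact_com !scalerA; congr (_ *: _).
by rewrite mulrC [X in _ * X]mulrC.
Qed.

Lemma ind_ex : exists (I : lmodType A)
    (t : {linear F -> kres I}) (u : {linear kres I -> F}),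
  [/\ cancel t u, cancel u t & forall l v, t (indT l v) = X l *: (t v : I)].
Proof. exact: Xmod (indT_rel _). Qed.

(** By Frobenius reciprocity it suffices to lift on the part of degree 0 in [X_i], over the
    variables in [s]; the lift then extends by letting powers of [X_i] act through [TU i]. *)
Lemma Sproj_ind s (I : lmodType A) (t : {linear F -> kres I})
    (u : {linear kres I -> F}) :
  cancel t u -> cancel u t -> (forall l v, t (indT l v) = X l *: (t v : I)) ->
  i \notin s -> Sproj s M -> Sproj (i :: s) I.
Proof.
move=> tu ut tE nsi Mp U V TU TV g f relU g_surj gT fT.
have ss l : l \in s -> l \in i :: s by move=> sl; rewrite inE sl orbT.
have ssi : i \in i :: s by exact: mem_head.
have relU' : qrel q a s TU.
  by split=> [l /ss/relU.1 //|l m /ss sl /ss sm]; exact: relU.2.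
have unit_indT l (m : M) : l != i ->
    indT l (unit_seq (a i) (kres M) m) = r l *: unit_seq (a i) (kres M) (X l *: m).
  move=> li; apply: entryP => e en; rewrite entry_indT //.
  rewrite entryZ !entry_unit.
  rewrite (leq_ltn_trans (leq0n e) en) andbT.
  by case: e en => [|e] _ /=; rewrite ?expr0 ?mulr1 // !scaler0.
(* On the part of degree 0 the variable [X l] acts with the extra scalar [r l], hence the scaled
   lifting property. *)
have [||h0 [h0P h0X]] := @Sproj_scaled s M r r_neq0 Mp U V TU TV g
    (comp_lin f (comp_lin t (unit_seq (a i) (kres M)))) relU' g_surj.
- by move=> l sl v; rewrite gT // ss.
- move=> l sl m; have li : l != i by apply: contraNneq nsi => <-.
  by rewrite /= -!linearZ /= -unit_indT // tE fT // ss.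
have h_lin : linear (fun x : kres I =>
    \sum_(e < a i) iter e (TU i) (h0 (entry (u x) e))).
  move=> b x y; rewrite scaler_sumr -big_split; apply: eq_bigr => e _ /=.
  by rewrite linearP entry_linear linearP iter_linear.
exists (mklin h_lin); split=> [x|l].
  rewrite /= linear_sum -[in RHS](ut x) [in RHS](shift_expansion (u x)) !linear_sum.
  apply: eq_bigr => e _; rewrite -entry_ord.
  elim: (e : nat) (entry (u x) e) => [|n IH] m; first by rewrite /= h0P.
  by rewrite [iter _ _ _]/= gT // IH -fT // -tE indT_eq.
rewrite inE => li m; rewrite /= linear_sum /=.
have -> : u (X l *: (m : I)) = indT l (u m) by apply: (can_inj tu); rewrite ut tE ut.
(* For [X i] the two sums agree after a shift of the index; the term lost at the top is killed by
   the [a i]-th power of [TU i]. *)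
have [->{l li}|l_ne] := eqVneq l i.
  have ai : (0 < a i)%N by exact: leq_trans (a_ge2 i).
  pose H e := TU i (iter e (TU i) (h0 (entry (u m) e))).
  rewrite -[RHS](sum_shift (H := H)) // /H.
    apply: eq_bigr => e _; rewrite indT_eq entry_shift ltn_ord.
    by case: (e : nat) => //=; rewrite linear0.
  by rewrite -iterS prednK // relU.1.
move: li; rewrite (negPf l_ne) /= => sl.
apply: eq_bigr => e _; rewrite entry_indT // (iter_com _ _ relU) // ?ss //.
by rewrite linearZ /= -h0X // !iterZ scalerA mulrC.
Qed.

End Induction.

(** * The two-step relative resolution of a module in the direction of [X_i] *)

Section RelativeSyzygy.
Variables (i : 'I_c) (M : lmodType A).
Notation n := (a i).
Notation F := {ffun 'I_n -> kres M}.
Notation x := (X i).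
Notation shift := (shift_lin n (kres M)).
Notation T0 := (indT i (fun=> 1) M).
Notation T1 := (indT i (fun l => q l i) M).

Let n_gt0 : (0 < n)%N. Proof. exact: leq_trans (a_ge2 i). Qed.

Definition xdiag : {linear F -> F} := diag_lin n (fun=> kact M x).

(** This is x (x) 1 - 1 (x) x on induced modules. Together with [mult_lin] and [power_seq] it is
    modelled on the periodic bimodule resolution of k[x]/(x^n). *)
Definition diff_lin : {linear F -> F} := sub_lin shift xdiag.

Lemma entry_diff f t :
  entry (diff_lin f) t = entry (shift f) t - x *: (entry f t : M).
Proof.
by rewrite -[diff_lin f]/(shift f - xdiag f) entryB entry_diag.
Qed.

Lemma diff_shift f : diff_lin (shift f) = shift (diff_lin f).
Proof.
apply: entryP => t tn; rewrite entry_diff !(entry_shift _ t) tn.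
case: t tn => [|t] tn; first by rewrite scaler0 subr0.
by rewrite entry_diff.
Qed.

(** The map raises the degree in [x] by one, or else moves [X l] past one more [x] inside [M].
    Either way a factor [q l i] appears, which the twist in [T1] absorbs. *)
Lemma diff_indT l f : diff_lin (T1 l f) = T0 l (diff_lin f).
Proof.
have [->|li] := eqVneq l i; first by rewrite !indT_eq diff_shift.
apply: entryP => t tn; rewrite entry_diff [RHS]entry_indT // entry_diff.
rewrite !entry_shift tn !entry_indT // mul1r !kres_mulC -exprS.
rewrite scalerBr [in RHS]scalerBr; congr (_ - _); last first.
  by rewrite (kact_com l i) [RHS]scalerA -exprSr.
case: t tn => [|t] tn; first by rewrite !scaler0.
by rewrite entry_indT // -exprS.
Qed.

Definition mult_lin_fun (f : F) : kres M := \sum_(e < n) x ^+ e *: (entry f e : M).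

Fact mult_lin_subproof : linear mult_lin_fun.
Proof.
move=> b f g; rewrite scaler_sumr -big_split; apply: eq_bigr => e _ /=.
by rewrite entry_linear scalerDr kres_mulC.
Qed.

Definition mult_lin : {linear F -> kres M} := mklin mult_lin_subproof.

Lemma mult_shift f : mult_lin (shift f) = x *: (mult_lin f : M).
Proof.
have -> : mult_lin (shift f) =
    \sum_(e < n) (if e : nat is p.+1 then x ^+ p.+1 *: (entry f p : M) else 0).
  apply: eq_bigr => e _; rewrite entry_shift ltn_ord.
  by case: (e : nat) => [|p]; rewrite ?scaler0.
rewrite (sum_shift (H := fun e => x ^+ e.+1 *: (entry f e : M))) //; last first.
  by rewrite prednK // Xpow scale0r.
by rewrite scaler_sumr; apply: eq_bigr => e _; rewrite scalerA -exprS.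
Qed.

Lemma mult_unit m : mult_lin (unit_seq n (kres M) m) = m.
Proof.
rewrite /= /mult_lin_fun (bigD1 (Ordinal n_gt0)) //= big1 => [|e].
  by rewrite addr0 expr0 scale1r entry_unit n_gt0.
by rewrite -val_eqE /= => e0; rewrite entry_unit (negPf e0) scaler0.
Qed.

Lemma mult_indT l f : mult_lin (T0 l f) = X l *: (mult_lin f : M).
Proof.
have [->|li] := eqVneq l i; first by rewrite indT_eq mult_shift.
rewrite scaler_sumr; apply: eq_bigr => e _; rewrite entry_indT // mul1r.
by rewrite kres_mulC -kact_iter_com.
Qed.

Lemma mult_diff f : mult_lin (diff_lin f) = 0.
Proof.
rewrite -[diff_lin f]/(shift f - xdiag f) linearB mult_shift.
apply/eqP; rewrite subr_eq0; apply/eqP.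
rewrite scaler_sumr; apply: eq_bigr => e _.
by rewrite entry_diag /= !scalerA -exprS -exprSr.
Qed.

Lemma xdiag_unit m :
  xdiag (unit_seq n (kres M) m) = unit_seq n (kres M) (x *: (m : M)).
Proof.
apply: entryP => t tn; rewrite entry_diag !entry_unit n_gt0 andbT.
by case: eqP => // _; rewrite linear0.
Qed.

(** Modulo the image of [diff_lin], x (x) m equals 1 (x) xm, so everything can be moved to degree 0.
    This gives exactness at the target of [diff_lin]. *)
Lemma diff_decomposition f :
  exists g, f = diff_lin g + unit_seq n (kres M) (mult_lin f).
Proof.
have step e (m : kres M) : exists g, iter e shift (unit_seq n (kres M) m) =
    diff_lin g + unit_seq n (kres M) (x ^+ e *: (m : M)).
  elim: e => [|e [g gE]]; first by exists 0; rewrite linear0 add0r expr0 scale1r.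
  pose w : F := unit_seq n (kres M) (x ^+ e *: (m : M)).
  exists (shift g + w); rewrite iterS gE (linearD shift) (linearD diff_lin).
  rewrite diff_shift -addrA; congr (_ + _).
  rewrite exprS -scalerA -xdiag_unit -[diff_lin w]/(shift w - xdiag w).
  by rewrite subrK.
have [g gE] := choice (fun e : 'I_n => step e (f e)).
exists (\sum_e g e); rewrite [LHS]shift_expansion (eq_bigr _ (fun e _ => gE e)).
rewrite big_split -(linear_sum diff_lin) -(linear_sum (unit_seq n (kres M))).
congr (_ + unit_seq _ _ _); apply: eq_bigr => e _.
by rewrite entry_ord.
Qed.

(** This sends [m] to the sum of the x^t (x) x^(n-1-t) m, the norm element of k[x]/(x^n) applied to
    [m]. *)
Definition power_seq : {linear kres M -> F} :=
  seq_lin n (fun e => kact M (x ^+ (n.-1 - e))).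

Lemma entry_power (m : M) t :
  entry (power_seq m) t = if (t < n)%N then x ^+ (n.-1 - t) *: m else 0.
Proof. by rewrite entry_seq_lin. Qed.

(** In degree [t], the twisted induced action contributes [t + 1] factors [q l i], and passing [X l]
    through x^(n-1-t) contributes the remaining ones. The total [n] does not depend on [t], which is
    where the automorphism sigma comes from. *)
Lemma power_indT l (m : M) :
  T1 l (power_seq m) = power_seq (q l i ^+ n *: (X l *: m : kres M)).
Proof.
apply: entryP => t tn; rewrite linearZ entryZ.
have [->|li] := eqVneq l i; last first.
  rewrite entry_indT // !entry_power tn -exprS.
  rewrite kact_iter_com scalerA -exprD.
  by rewrite addSn subnKC ?prednK // -ltnS prednK.
rewrite indT_eq q_comm.1 expr1n scale1r entry_shift !entry_power tn.
rewrite [RHS]scalerA -exprSr; case: t tn => [|t] tn.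
  by rewrite subn0 prednK // Xpow scale0r.
by rewrite entry_power (ltnW tn) subnS prednK // subn_gt0 -ltnS prednK.
Qed.

(** An element of the kernel satisfies f_t = x f_(t+1), so it is determined by its top entry, which
    serves as the witness. *)
Lemma diff_kernel f : diff_lin f = 0 <-> exists m, power_seq m = f.
Proof.
split=> [df|[m <-]]; last first.
  apply: entryP => t tn; rewrite entry0 entry_diff entry_shift tn.
  rewrite !entry_power tn scalerA -exprS; case: t tn => [|t] tn.
    by rewrite subn0 prednK // Xpow scale0r subr0.
  rewrite entry_power (ltnW tn) subnS prednK ?subrr //.
  by rewrite subn_gt0 -ltnS prednK.
have fS t : (t.+1 < n)%N -> entry f t = x *: (entry f t.+1 : M).
  move=> tn; have := entry_diff f t.+1; rewrite df entry0 entry_shift tn.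
  by move=> /eqP; rewrite eq_sym subr_eq0 => /eqP.
exists (entry f n.-1); apply: entryP => t tn; rewrite entry_power tn.
have [d dE] : exists d, n.-1 = (t + d)%N.
  by exists (n.-1 - t)%N; rewrite subnKC // -ltnS prednK.
rewrite dE addKn; elim: d t tn dE => [|d IH] t tn dE.
  by rewrite addn0 expr0 scale1r.
have tn' : (t.+1 < n)%N by rewrite -(prednK n_gt0) dE ltnS addnS ltnS leq_addr.
by rewrite (fS t) // -(IH t.+1) ?addSnnS // scalerA -exprS.
Qed.

Lemma relative_syzygy s (M' : lmodType A) :
  twist (fun l => q l i ^+ n) M M' -> i \notin s -> Sproj s M ->
  exists (Z I I' : lmodType A) (j : {linear Z -> I}) (p : {linear I -> M})
    (j' : {linear M' -> I'}) (p' : {linear I' -> Z}),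
  [/\ ses j p, ses j' p', Sproj (i :: s) I & Sproj (i :: s) I'].
Proof.
move=> [h [h' [hK h'K hX]]] nsi Mp.
have [I [t [u [tu ut tE]]]] := ind_ex i (fun=> 1) M.
have [I' [t' [u' [tu' ut' tE']]]] := ind_ex i (fun l => q l i) M.
have Ip : Sproj (i :: s) I.
  by apply: (Sproj_ind _ tu ut tE nsi Mp) => l; exact: oner_neq0.
have I'p : Sproj (i :: s) I'.
  by apply: (Sproj_ind _ tu' ut' tE' nsi Mp) => l; exact: q_neq0.
have uE l (m : I) : u (X l *: m) = T0 l (u m).
  by apply: (can_inj tu); rewrite ut tE ut.
have uE' l (m : I') : u' (X l *: m) = T1 l (u' m).
  by apply: (can_inj tu'); rewrite ut' tE' ut'.
have [|p pE] := gen_linear (f := comp_lin mult_lin u).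
  by move=> l m; rewrite -[LHS]/(mult_lin (u _)) uE mult_indT.
have [|d dE] := gen_linear (f := comp_lin t (comp_lin diff_lin u')).
  by move=> l m; rewrite -[LHS]/(t (diff_lin (u' _))) uE' diff_indT tE.
have [|j' jE'] := gen_linear (f := comp_lin t' (comp_lin power_seq h)).
  by move=> l m; rewrite -[LHS]/(t' (power_seq (h _))) hX -power_indT tE'.
have p_surj m : exists y, p y = m.
  by exists (t (unit_seq n (kres M) m)); rewrite pE /= tu; exact: mult_unit.
have sjp := ker_ses p_surj; have [j_inj _ exj] := sjp.
have [|p' pE'] := ker_lift (g := d) sjp.
  by move=> y; rewrite pE dE /= tu; exact: mult_diff.
exists (ker_type p), I, I', (ker_incl p), p, j', p'; split=> //; split.
- move=> y z yz; apply: (can_inj hK).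
  have hyz : power_seq (h y) = power_seq (h z).
    by apply: (can_inj tu'); move: (jE' y) (jE' z) => /= <- <-; rewrite yz.
  (* The top entry of [power_seq m] is x^0 m = m, which gives injectivity. *)
  have := congr1 (fun f => entry f n.-1) hyz.
  by rewrite !entry_power ltn_predL n_gt0 subnn expr0 !scale1r.
- move=> z; have pz : p (ker_incl p z) = 0 by apply/exj; exists z.
  (* On the kernel of multiplication the degree 0 term of the decomposition vanishes, leaving an
     element of the image of [diff_lin]. *)
  have [g gE] := diff_decomposition (u (ker_incl p z)).
  exists (t' g); apply: j_inj; rewrite pE' dE /= tu' -[RHS]ut gE.
  by rewrite -[mult_lin _]/(comp_lin mult_lin u _) -pE pz linear0 addr0.
move=> y; have -> : p' y = 0 <-> diff_lin (u' y) = 0.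
  have Ey : ker_incl p (p' y) = t (diff_lin (u' y)) by rewrite pE' dE.
  split=> [y0|y0].
    by apply: (can_inj tu); rewrite -Ey y0 !linear0.
  by apply: j_inj; rewrite Ey y0 !linear0.
rewrite diff_kernel; split=> [[m mE]|[m <-]].
  by exists (h' m); rewrite jE' -[LHS]/(t' (power_seq (h (h' m)))) h'K mE ut'.
by exists (h m); rewrite jE' -[RHS]/(u' (t' (power_seq (h m)))) tu'.
Qed.

End RelativeSyzygy.

(** Over no variables every module is projective, and each further variable is added by passing to
    an induced cover. *)
Lemma Sproj_cover s (M : lmodType A) : uniq s ->
  exists (J : lmodType A) (p : {linear J -> M}),
    Sproj s J /\ forall m, exists e, p e = m.
Proof.
elim: s => [|i s IH] /=.
  by move=> _; exists M, (id_lin M); split; [exact: Sproj_nil | move=> m; exists m].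
move=> /andP[nsi /IH[J [p [Jp p_surj]]]].
have [J' J'J] := twist_ex (fun l => q l i ^+ a i) J.
have [Z [I [_ [_ [u [_ [_ [[_ u_surj _] _ Ip _]]]]]]]] := relative_syzygy J'J nsi Jp.
exists I, (comp_lin p u); split=> // m.
by have [e <-] := p_surj m; have [y <-] := u_surj e; exists y.
Qed.

(** A projective [A]-module splits off from its cover by a module that is projective over the
    subalgebra. *)
Lemma Sproj_projective s (P : lmodType A) : uniq s -> projective P -> Sproj s P.
Proof.
move=> s_uniq Pp; have [J [p [Jp p_surj]]] := Sproj_cover P s_uniq.
have [t tP] := Pp _ _ p (id_lin P) p_surj.
exact: Sproj_retract tP Jp.
Qed.

(* In the stable category: K is the cone of a map Omega W -> R, and K' that of
   the induced map Omega W' -> R'. *)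
Lemma cone_step s (R K W R' I : lmodType A)
    (j : {linear R -> K}) (p : {linear K -> W})
    (j' : {linear R' -> I}) (p' : {linear I -> R})
    (W' Q : lmodType A) (j2 : {linear W' -> Q}) (p2 : {linear Q -> W}) :
  uniq s -> ses j p -> ses j' p' -> ses j2 p2 -> projective Q ->
  Sproj s K -> Sproj s I ->
  exists (K' : lmodType A) (i : {linear R' -> K'}) (v : {linear K' -> W'}),
    ses i v /\ Sproj s K'.
Proof.
move=> s_uniq sjp sjp' sjp2 Qp Kp Ip.
have [j_inj p_surj ex] := sjp; have [j'_inj p'_surj ex'] := sjp'.
have [j2_inj p2_surj ex2] := sjp2.
have [l lP] := Qp _ _ p p2 p_surj.
(* [K'] is the kernel of this surjection: [R'] sits in it through [I], and its projection to [Q]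
   lands in [W']. *)
pose d : {linear (I * Q)%type -> K} := copair_lin (comp_lin j p') l.
have d_surj y : exists e, d e = y.
  have [u uP] := p2_surj (p y).
  have /ex[z zP] : p (y - l u) = 0 by rewrite linearB lP uP subrr.
  by have [w wP] := p'_surj z; exists (w, u); rewrite /= wP zP subrK.
have sd := ker_ses d_surj.
have K'p : Sproj s (ker_type d).
  by apply: Sproj_kernel sd (Sproj_pair Ip _) Kp; exact: Sproj_projective.
have [i iP] : exists i : {linear R' -> ker_type d},
    forall z, ker_incl d (i z) = (j' z, 0).
  apply: (ker_lift (g := pair_lin j' (zero_lin R' Q)) sd) => z.
  by rewrite /= (ses0 sjp') linear0 add0r linear0.
have [e_inj _ exd] := sd.
have [v vP] : exists v : {linear ker_type d -> W'},
    forall y, j2 (v y) = (ker_incl d y).2.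
  apply: (ker_lift (g := comp_lin (snd_lin I Q) (ker_incl d)) sjp2) => y.
  have : d (ker_incl d y) = 0 by apply/exd; exists y.
  by move=> /(congr1 p); rewrite /= linearD lP (ses0 sjp) add0r linear0.
exists (ker_type d), i, v; split=> //; split=> [y z|w|y].
- by move=> /(congr1 (ker_incl d)); rewrite !iP => -[/j'_inj].
- have /ex[z zP] : p (- l (j2 w)) = 0 by rewrite linearN lP (ses0 sjp2) oppr0.
  have [u uP] := p'_surj z.
  have /exd[y yP] : d (u, j2 w) = 0 by rewrite /= uP zP addNr.
  by exists y; apply: j2_inj; rewrite vP yP.
- split=> [y0|[z <-]]; last by apply: j2_inj; rewrite vP iP linear0.
  have y2 : (ker_incl d y).2 = 0 by rewrite -vP y0 linear0.
  have dy : d (ker_incl d y) = 0 by apply/exd; exists y.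
  have /j_inj/ex'[z zP] : j (p' (ker_incl d y).1) = j 0.
    rewrite linear0 -dy.
    rewrite -[RHS]/(j (p' (ker_incl d y).1) + l (ker_incl d y).2).
    by rewrite y2 linear0 addr0.
  by exists z; apply: e_inj; rewrite iP zP -y2; case: (ker_incl d y).
Qed.

(** * Splicing the sequences until the twist becomes trivial *)

Section Cone.
Variables (i : 'I_c) (s : seq 'I_c) (M : lmodType A).
Hypotheses (nsi : i \notin s) (s_uniq : uniq s) (Mp : Sproj s M).

Let sigma (l : 'I_c) := q l i ^+ a i.

Let sigma_neq0 n l : sigma l ^+ n != 0.
Proof. by rewrite !expf_neq0 // q_neq0. Qed.

(** [W] is an iterated syzygy of [M] of order 2n+1, so [K] is the cone of a stable map from
    Omega^(2n+2) M to the twist [M']. *)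
Lemma twisted_cone n (M' : lmodType A) : twist (fun l => sigma l ^+ n.+1) M M' ->
  exists (K W : lmodType A) (j : {linear M' -> K}) (p : {linear K -> W}),
    [/\ ses j p, Sproj (i :: s) K
      & forall (N : lmodType A) m, extv (m + n.*2.+1) M N <-> extv m W N].
Proof.
have is_uniq : uniq (i :: s) by rewrite /= nsi.
elim: n M' => [|n IH] M' MM'.
  (* The first half of the sequence already exhibits [I] as a cone with [R = Z] and [W = M], so one
     cone step suffices here. *)
  have [Z [I [I' [j [p [j' [p' [sjp sjp' Ip I'p]]]]]]]] :=
    @relative_syzygy i M s M' MM' nsi Mp.
  have [W' [Q [j2 [p2 [Qp s2]]]]] := projective_presentation M.
  have [K [u [v [suv Kp]]]] := cone_step is_uniq sjp sjp' s2 Qp Ip I'p.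
  exists K, W', u, v; split=> // N m; rewrite addn1; exact: extv_shift s2 Qp.
have [M1 MM1] := twist_ex (fun l => sigma l ^+ n.+1) M.
have [K [W [j [p [sjp Kp extW]]]]] := IH M1 MM1.
have M1M' : twist sigma M1 M'.
  apply: (twist_div _ MM1 (r' := sigma)); first exact: sigma_neq0.
  by under [fun l => _]eq_fun do rewrite -exprSr.
have M1p : Sproj s M1 by apply: Sproj_twist MM1 Mp; exact: sigma_neq0.
(* The sequence for [M1] is spliced on by two cone steps, one for each of its halves; each replaces
   [W] by its syzygy. *)
have [Z [I [I' [j0 [p0 [j' [p' [s0 s' Ip I'p]]]]]]]] :=
  relative_syzygy M1M' nsi M1p.
have [W1 [Q1 [j1 [p1 [Q1p s1]]]]] := projective_presentation W.
have [K1 [u1 [v1 [suv1 K1p]]]] := cone_step is_uniq sjp s0 s1 Q1p Kp Ip.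
have [W2 [Q2 [j2 [p2 [Q2p s2]]]]] := projective_presentation W1.
have [K2 [u2 [v2 [suv2 K2p]]]] := cone_step is_uniq suv1 s' s2 Q2p K1p I'p.
exists K2, W2, u2, v2; split=> // N m.
have -> : (m + n.+1.*2.+1 = m.+2 + n.*2.+1)%N by rewrite doubleS !addSn !addnS.
apply: (iff_trans (extW N _)).
apply: (iff_trans (extv_shift _ _ s1 Q1p)); exact: extv_shift s2 Q2p.
Qed.

Hypothesis q_root : forall l, exists2 n : nat, (0 < n)%N & q l i ^+ n = 1.

Lemma cone : exists n (K W : lmodType A) (j : {linear M -> K}) (p : {linear K -> W}),
    [/\ ses j p, Sproj (i :: s) K
      & forall (N : lmodType A) m, extv (m + n.+1) M N <-> extv m W N].
Proof.
have [n n_gt0 qn] : exists2 n, (0 < n)%N & forall l, q l i ^+ n = 1.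
  have [f f_gt0 fP] : exists2 f : 'I_c -> nat, forall l, (0 < f l)%N
      & forall l, q l i ^+ f l = 1.
    have /choice[f fP] : forall l, exists n, (0 < n)%N /\ q l i ^+ n = 1.
      by move=> l; have [n] := q_root l; exists n.
    by exists f => l; have [] := fP l.
  (* The product of the orders is a common exponent for all the [q l i]. *)
  exists (\prod_l f l)%N => [|l]; first by rewrite prodn_gt0.
  by rewrite (bigD1 l) //= exprM fP expr1n.
(* Since sigma^n = 1, the module [M] is its own [n]-fold twist through the identity. *)
have [|K [W [j [p [sjp Kp extW]]]]] := @twisted_cone n.-1 M.
  exists (id_lin (kres M)), (id_lin (kres M)); split=> // l m /=.
  by rewrite /sigma prednK // -exprM mulnC exprM qn expr1n scale1r.
by exists n.-1.*2, K, W, j, p.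
Qed.

End Cone.

Hypothesis q_root : forall i j, exists2 n : nat, (0 < n)%N & q i j ^+ n = 1.

(** The induction is on the list [r] of variables over which projectivity is not yet known; once it
    is empty, [M] is projective over [A]. *)
Lemma extv_no_gap_Sproj r s (M N : lmodType A) m : uniq (r ++ s) ->
  (forall i, i \in r ++ s) -> Sproj s M ->
  (forall n, (m <= n)%N -> extv n M N) -> forall n, extv n M N.
Proof.
elim: r s M m => [|i r IH] s M m /=.
  move=> _ s_full Mp _ n; apply: extv_projective; exact: Sproj_full Mp.
move=> /andP[]; rewrite mem_cat negb_or => /andP[nri nsi] rs_uniq full Mp extM.
have s_uniq : uniq s by have := rs_uniq; rewrite cat_uniq => /and3P[].
have [d [K [W [j [p [sjp Kp extW]]]]]] := cone nsi s_uniq Mp (fun l => q_root l i).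
(* [K] is an extension of a syzygy of [M] by [M], so its Ext vanishes eventually; being projective
   over one more variable, it falls under the induction hypothesis. *)
have extK : forall n, extv n K N.
  apply: (IH (i :: s) K m) => //.
  - by rewrite uniq_catC /= mem_cat negb_or nsi nri uniq_catC.
  - by move=> l; have := full l; rewrite !(inE, mem_cat) orbCA.
  move=> n mn; apply: (extv_middle sjp); first exact: extM.
  by apply/extW/extM; rewrite (leq_trans mn) ?leq_addr.
(* Vanishing descends from above: with Ext of [K] zero, [extv n M N] follows from [extv n.+1 W N],
   which is [extv] of [M] in a strictly larger degree. *)
have key e n : (m <= n + e)%N -> extv n M N.
  elim: e n => [|e IHe] n; first by rewrite addn0; exact: extM.
  move=> mn; apply: (extv_left sjp); first exact: extK.
  apply/extW/IHe; apply: leq_trans mn _.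
  by rewrite addnS -addSn leq_add2r leq_addr.
by move=> n; apply: (key m); rewrite leq_addl.
Qed.

Lemma extv_no_gap (M N : lmodType A) m :
  (forall n, (m <= n)%N -> extv n M N) -> forall n, extv n M N.
Proof.
move=> extM; apply: (@extv_no_gap_Sproj (enum 'I_c) [::] M N m) => //.
- by rewrite cats0 enum_uniq.
- by move=> i; rewrite cats0 mem_enum.
- exact: Sproj_nil.
Qed.

End Periodicity.

(** * Duality *)

Section Finiteness.
Variables (k : fieldType) (c : nat) (q : 'M[k]_c) (a : 'I_c -> nat).
Hypothesis a_ge2 : forall i, (2 <= a i)%N.
Variables (A : algType k) (X : 'I_c -> A).
Hypothesis Xpow : forall i, X i ^+ a i = 0.
Hypothesis Xcom : forall i j, X i * X j = q i j *: (X j * X i).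
Hypothesis Xind : forall P : A -> Prop,
  P 1 -> (forall i x, P x -> P (X i * x)) ->
  (forall b x y, P x -> P y -> P (b *: x + y)) -> forall x, P x.

Definition kspan (V : lmodType k) (I : Type) (v : I -> V) (m : V) : Prop :=
  forall S : V -> Prop, subspace S -> (forall i, S (v i)) -> S m.

Lemma kspan_subspace (V : lmodType k) I (v : I -> V) : subspace (kspan v).
Proof.
split=> [S [S0 _] //|b x y xv yv S S_sub Sv].
by apply: S_sub.2; [exact: xv | exact: yv].
Qed.

Lemma kspan_gen (V : lmodType k) I (v : I -> V) i : kspan v (v i).
Proof. by move=> S _; exact. Qed.

Lemma kspan_trans (V W : lmodType k) (f : {linear V -> W}) I J (v : I -> V)
    (w : J -> W) m :
  (forall i, kspan w (f (v i))) -> kspan v m -> kspan w (f m).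
Proof.
move=> vw vm; apply: (vm (fun m => kspan w (f m))) => //.
have [w0 wD] := kspan_subspace w.
by split=> [|b x y xw yw]; rewrite ?linear0 // linearP; exact: wD.
Qed.

Lemma kspan_fg (V : lmodType k) (I : finType) (v : I -> V) :
  (forall m, kspan v m) -> finitely_generated V.
Proof.
move=> v_gen; exists #|I|, (fun i => v (enum_val i)) => m.
apply: (v_gen m (fun m => exists x, m = \sum_i x i *: v (enum_val i))).
  split; first by exists (fun=> 0); rewrite big1 // => i _; rewrite scale0r.
  move=> b _ _ [x ->] [y ->]; exists (fun i => b * x i + y i).
  rewrite scaler_sumr -big_split; apply: eq_bigr => i _ /=.
  by rewrite scalerDl scalerA.
move=> i; exists (fun j => (j == enum_rank i)%:R).
rewrite (bigD1 (enum_rank i)) //= eqxx scale1r enum_rankK big1 ?addr0 //.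
by move=> j /negPf->; rewrite scale0r.
Qed.

(** A finite family whose span is stable under the variables in [s] is enlarged by the powers of the
    next variable; moving a variable past such a power costs only a scalar. *)
Lemma fg_kres (M : lmodType A) : finitely_generated M -> finitely_generated (kres M).
Proof.
move=> [n [g gP]].
have main (s : seq 'I_c) : exists (I : finType) (v : I -> kres M),
    (forall j, kspan v (g j)) /\
    forall l, l \in s -> forall i, kspan v (X l *: (v i : M)).
  elim: s => [|j s [I [v [gv vX]]]].
    by exists 'I_n, g; split=> [j|l //]; exact: (@kspan_gen (kres M) _ g j).
  pose w (e : 'I_(a j) * I) : kres M := X j ^+ e.1 *: (v e.2 : M).
  have wE e m : (e < a j)%N -> kspan v m -> kspan w (X j ^+ e *: (m : M)).
    move=> ea; apply: (kspan_trans (f := kact M (X j ^+ e))) => i.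
    exact: (@kspan_gen _ _ w (Ordinal ea, i)).
  exists ('I_(a j) * I)%type, w; split=> [i|l ls [e i]].
    have := wE 0%N (g i) (leq_trans _ (a_ge2 j)) (gv i).
    by rewrite expr0 scale1r; exact.
  rewrite /w /=; have [->|lj] := eqVneq l j.
    rewrite scalerA -exprS; have := ltn_ord e; rewrite leq_eqVlt => /predU1P[->|ea].
      by rewrite Xpow scale0r; exact: (kspan_subspace w).1.
    exact: wE ea (@kspan_gen _ _ v i).
  have sl : l \in s by move: ls; rewrite inE (negPf lj).
  rewrite (kact_iter_com Xpow Xcom).
  have [w0 wD] := kspan_subspace w; rewrite -[_ *: _]addr0; apply: wD => //.
  by apply: wE => //; exact: vX.
have [I [v [gv vX]]] := main (enum 'I_c).
apply: (kspan_fg (v := v)) => m; have [v0 vD] := kspan_subspace v.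
have vA x (m' : M) : kspan v m' -> kspan v (x *: m').
  elim/Xind: x m' => [|i x IH|b x y IHx IHy] m' m'v.
  - by rewrite scale1r.
  - rewrite -scalerA; apply: (kspan_trans (f := kact M (X i))) (IH _ m'v).
    by move=> j; apply: vX; rewrite mem_enum.
  - by rewrite scalerDl kres_mul; apply: vD; [exact: IHx | exact: IHy].
have [x ->] := gP m; elim/big_rec: _ => [|i y _ yv]; first exact: v0.
by have := vD 1 _ _ (vA (x i) _ (gv i)) yv; rewrite scale1r.
Qed.

End Finiteness.

(** * Free modules of finite rank as row vectors *)

Section Rows.
Variables (A : nzRingType) (n : nat).
Notation F := ('rV[A]_n : lmodType A).

Definition row_lin_fun (N : lmodType A) (y : 'I_n -> N) (r : F) : N :=
  \sum_s r 0 s *: y s.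
Fact row_lin_subproof (N : lmodType A) (y : 'I_n -> N) : linear (row_lin_fun y).
Proof.
move=> b u v; rewrite scaler_sumr -big_split; apply: eq_bigr => s _ /=.
by rewrite !mxE scalerDl scalerA.
Qed.
Definition row_lin (N : lmodType A) (y : 'I_n -> N) : {linear F -> N} :=
  mklin (row_lin_subproof y).

Notation e := (fun s => delta_mx 0 s : F).

Lemma row_linE (N : lmodType A) (f : {linear F -> N}) r :
  f r = \sum_s r 0 s *: f (e s).
Proof.
by rewrite {1}[r]row_sum_delta linear_sum; apply: eq_bigr => s _; rewrite linearZ.
Qed.

Lemma row_lin_delta (N : lmodType A) (y : 'I_n -> N) s : row_lin y (e s) = y s.
Proof.
rewrite /= /row_lin_fun (bigD1 s) //= mxE !eqxx scale1r big1 ?addr0 // => j js.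
by rewrite mxE (negPf js) andbF scale0r.
Qed.

Lemma row_projective : projective F.
Proof.
move=> U V g f g_surj; have [u gu] := choice (fun s => g_surj (f (e s))).
exists (row_lin u) => r; rewrite (row_linE f) /= /row_lin_fun linear_sum.
by apply: eq_bigr => s _; rewrite linearZ gu.
Qed.

Lemma row_fg : finitely_generated F.
Proof.
by exists n, e => m; exists (fun s => m 0 s); rewrite {1}[m]row_sum_delta.
Qed.

End Rows.

Lemma fg_quotient (A : nzRingType) (U V : lmodType A) (p : {linear U -> V}) :
  (forall v, exists u, p u = v) -> finitely_generated U -> finitely_generated V.
Proof.
move=> p_surj [n [g gP]]; exists n, (fun i => p (g i)) => m.
have [u <-] := p_surj m; have [x ->] := gP u; exists x.
by rewrite linear_sum; apply: eq_bigr => i _; rewrite linearZ.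
Qed.

(** The induction is on the number of vectors that span [W] modulo the image of [h]. A vector
    outside the image is adjoined to the source as a new coordinate, at the price of one more
    functional. *)
Lemma separating_functionals (k : fieldType) (V W : lmodType k)
    (h : {linear V -> W}) : finitely_generated W ->
  exists n (m : 'I_n -> {linear W -> k^o}),
    forall w, (forall s, m s w = 0) <-> exists v, h v = w.
Proof.
move=> [d [v vP]].
have : forall w, exists x b, w = h x + \sum_(i < d) b i *: v i.
  by move=> w; have [b ->] := vP w; exists 0, b; rewrite linear0 add0r.
elim: d v {vP} V h => [|d IH] v V h hv.
  have m : 'I_0 -> {linear W -> k^o} by case.
  exists 0%N, m => w; split=> [_|_ []//].
  by have [x [b ->]] := hv w; exists x; rewrite big_ord0 addr0.
have [[x0 x0P]|nvh] := EM (exists x, h x = v ord_max).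
  apply: (IH (fun i => v (widen_ord (leqnSn d) i)) V h) => w.
  have [x [b ->]] := hv w; rewrite big_ord_recr -x0P /=.
  exists (b ord_max *: x0 + x), (fun i => b (widen_ord (leqnSn d) i)).
  by rewrite linearP addrA addrC addrA.
set v0 := v ord_max in hv nvh.
have v0_lin : linear (fun b : k^o => b *: v0).
  by move=> b x y; rewrite scalerDl scalerA.
have [h' h'E] : exists h' : {linear (V * k^o)%type -> W},
    forall x b, h' (x, b) = h x + b *: v0 by exists (copair_lin h (mklin v0_lin)).
have [|n [m mP]] := IH (fun i => v (widen_ord (leqnSn d) i)) _ h'.
  move=> w; have [x [b ->]] := hv w; rewrite big_ord_recr /=.
  exists (x, b ord_max), (fun i => b (widen_ord (leqnSn d) i)).
  by rewrite h'E addrA addrAC.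
(* [m0] reads off the coefficient of [v0], which is well defined on the image of [h'] because [v0]
   is not in the image of [h]. *)
have [|m0 m0P] := @linear_extension _ k^o _ _ h' (snd_lin V k^o).
  move=> [x b]; rewrite h'E /= => xb; have [//|b0] := eqVneq b 0.
  case: nvh; exists (- b^-1 *: x); move/eqP: xb; rewrite addr_eq0 => /eqP xb.
  by rewrite linearZ /= xb scaleNr scalerN opprK scalerA mulVf // scale1r.
exists n.+1, (fun s => if unlift ord_max s is Some s' then m s' else m0) => w.
split=> [mw|[x <-] s].
  have [|[x b] xbw] := (mP w).1.
    by move=> s; have := mw (lift ord_max s); rewrite liftK.
  have := mw ord_max; rewrite unlift_none -xbw m0P /= => b0.
  by exists x; rewrite h'E b0 scale0r addr0.
case: unliftP => [s' _|_]; last first.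
  by have := m0P (x, 0); rewrite h'E scale0r addr0.
by apply: ((mP (h x)).2 _ s'); exists (x, 0); rewrite h'E scale0r addr0.
Qed.

Definition mkscalar (k : fieldType) (A : algType k) (f : A -> k)
  (f_lin : scalar f) : dual A :=
  HB.pack f (GRing.isLinear.Build k A k *%R f f_lin).

(** * Symmetrizing form, self-injectivity and cosyzygies *)

Section Duality.
Variables (k : fieldType) (A : algType k).
Implicit Types M N C Z E : lmodType A.

(** The form is [phi 1]: left and right linearity give [phi x y = t (y * x) = t (x * y)]. *)
Lemma symmetric_form : symmetric_algebra A -> exists t : dual A,
  [/\ forall x y, t (x * y) = t (y * x),
      forall x, (forall b, t (b * x) = 0) -> x = 0
    & forall f : dual A, exists x, forall b, t (b * x) = f b].
Proof.
move=> [phi [phiD phil phir phi_inj phi_surj]]; exists (phi 1).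
have phiE x y : phi x y = phi 1 (y * x) by rewrite -[x in LHS]mulr1 phil.
have phiE' x y : phi x y = phi 1 (x * y) by rewrite -[x in LHS]mul1r phir.
split=> [x y|x x0|f]; first by rewrite -phiE' phiE.
  apply: phi_inj => y; rewrite phiE x0 phiE mulr0.
  by rewrite linear0.
by have [x xP] := phi_surj f; exists x => b; rewrite -phiE xP.
Qed.

Variable t : dual A.
Hypothesis tC : forall x y, t (x * y) = t (y * x).
Hypothesis t_inj : forall x, (forall b, t (b * x) = 0) -> x = 0.
Hypothesis t_surj : forall f : dual A, exists x, forall b, t (b * x) = f b.
Hypothesis fg_fin : forall M, finitely_generated M -> finitely_generated (kres M).

Notation row n := ('rV[A]_n : lmodType A).

Lemma row_eq n (x y : row n) :
  (forall b s, t (b * x 0 s) = t (b * y 0 s)) -> x = y.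
Proof.
move=> xy; apply/rowP => s; apply/eqP; rewrite -subr_eq0; apply/eqP/t_inj => b.
by rewrite mulrBr linearB /= xy subrr.
Qed.

Lemma tZ (b : k) x : t ((b%:A : A) * x) = b * t x.
Proof. by rewrite -scalerAl mul1r linearZ. Qed.

Definition row_functional n (s : 'I_n) : {linear kres (row n) -> k^o}.
Proof.
refine (@mklin k (kres (row n)) k^o (fun x => t ((x : 'rV[A]_n) 0 s)) _) => b x y.
by rewrite mxE linearD /= mxE tZ.
Defined.

(* Hom_A(N, A) = Hom_k(N, k) through the symmetrizing form. *)
Lemma functional_lift N n (l : 'I_n -> {linear kres N -> k^o}) :
  exists g : {linear N -> row n}, forall b y s, t (b * g y 0 s) = l s (b *: y).
Proof.
have ex (y : N) (s : 'I_n) : exists x, forall b, t (b * x) = l s (b *: y).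
  have f_lin : scalar (fun b : A => l s (b *: y) : k).
    by move=> d u v; rewrite scalerDl linearD /= kres_mul linearZ.
  by have [x xP] := t_surj (mkscalar f_lin); exists x.
have [g gP] : exists g : N -> row n, forall b y s, t (b * g y 0 s) = l s (b *: y).
  have ex' y : exists f : 'I_n -> A, forall s b, t (b * f s) = l s (b *: y).
    by have [f fP] := choice (ex y); exists f.
  have [g gP] := choice ex'.
  by exists (fun y => \row_s g y s) => b y s; rewrite mxE gP.
have g_lin : linear g.
  move=> d y z; apply: row_eq => b s.
  by rewrite gP !mxE mulrDr linearD /= mulrA !gP scalerDr linearD /= scalerA.
by exists (mklin g_lin).
Qed.

(** The coordinates of [f] composed with [t] extend [k]-linearly to [V], and [functional_lift] turns
    the extensions back into an [A]-linear map. *)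
Lemma row_injective n (U V : lmodType A)
    (i : {linear U -> V}) (f : {linear U -> row n}) :
  injective i -> exists g : {linear V -> row n}, forall u, g (i u) = f u.
Proof.
move=> i_inj.
have /choice[l lP] : forall s, exists l : {linear kres V -> k^o},
    forall u, l (i u) = t (f u 0 s).
  move=> s.
  apply: (linear_extension (h := kmap i)
    (l := comp_lin (row_functional s) (kmap f))) => u /= iu.
  have -> : u = 0 by apply: i_inj; rewrite linear0.
  by rewrite linear0 mxE linear0.
have [g gP] := functional_lift l; exists g => u; apply: row_eq => b s.
by rewrite gP -linearZ lP linearZ mxE.
Qed.

(** Finitely many functionals cut out the image of [h]. Their [A]-linear lift has the same kernel
    because that image is a submodule. *)
Lemma coker_embedding M N (h : {linear M -> N}) : finitely_generated N ->
  exists n (f : {linear N -> row n}), forall y, f y = 0 <-> exists x, h x = y.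
Proof.
move=> /fg_fin N_fin; have [n [m mP]] := separating_functionals (kmap h) N_fin.
have [f fP] := functional_lift m; exists n, f => y; split=> [fy|[x <-]].
  apply/(mP y) => s; have := fP 1 y s.
  by rewrite fy mxE mulr0 linear0 scale1r.
apply: row_eq => b s; rewrite fP mxE mulr0 linear0 -linearZ.
by apply: ((mP (h (b *: x))).2 _ s); exists (b *: x).
Qed.

Lemma cosyzygy M : finitely_generated M ->
  exists n C (j : {linear M -> row n}) (p : {linear row n -> C}),
    ses j p /\ finitely_generated C.
Proof.
move=> M_fg; have [n [j jP]] := coker_embedding (zero_lin M M) M_fg.
have j_inj : injective j by apply: lin_inj => x /jP[x0 <-].
(* The cokernel of [j] is realised without a quotient: it is the image of [d], presented as the
   kernel of [e]. *)
have [m [d dP]] := coker_embedding j (row_fg A n).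
have [l [e eP]] := coker_embedding d (row_fg A m).
have inj : injective (ker_incl e) by exact: val_inj.
have [p pP] : exists p : {linear row n -> ker_type e},
    forall y, ker_incl e (p y) = d y.
  by apply: inj_lift => // y; apply/ker_inclP/eP; exists y.
have p_surj z : exists y, p y = z.
  have /eP[y yP] : e (ker_incl e z) = 0 by apply/ker_inclP; exists z.
  by exists y; apply: inj; rewrite pP.
exists n, (ker_type e), j, p; split; last exact: fg_quotient p_surj (row_fg A n).
split=> // y; rewrite -dP -pP; split=> [->|]; first by rewrite linear0.
by rewrite -[X in _ = X -> _](linear0 (ker_incl e)) => /inj.
Qed.

(** * Duality between maps out of and into free modules *)

Section TraceDuality.
Variables (N : lmodType A) (n0 n1 n2 : nat).
Variables (d0 : {linear row n0 -> row n1}) (d1 : {linear row n1 -> row n2}).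
Hypothesis exN : forall y : {linear row n1 -> N}, (forall r, y (d0 r) = 0) ->
  exists z : {linear row n2 -> N}, forall r, y r = z (d1 r).

Notation e := (fun s => delta_mx 0 s).
Notation Nn n := {ffun 'I_n -> kres N}.

Let ev n (y : Nn n) : {linear row n -> N} := row_lin (y : 'I_n -> N).

Let pull_fun (y : Nn n1) : Nn n0 := [ffun r => ev y (d0 (e r))].

Let pull_linear : linear pull_fun.
Proof.
move=> b y z; apply/ffunP => r; rewrite !ffunE /= /row_lin_fun.
rewrite scaler_sumr -big_split; apply: eq_bigr => s _ /=.
by rewrite !ffunE scalerDr kres_mulC.
Qed.
Let pull := mklin pull_linear.

Let single_linear n (r : 'I_n) :
  linear (fun w : kres N => [ffun r' => if r' == r then w else 0] : Nn n).
Proof.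
move=> b x y; apply/ffunP => r'; rewrite !ffunE.
by case: eqP => // _; rewrite scaler0 addr0.
Qed.
Let single n r := mklin (@single_linear n r).

(** Through [t], an [A]-linear map from [N] to A^n is a functional on N^n = Hom_A(A^n, N); [f] is
    first found in this form, as [mu]. *)
Lemma trace_duality (g : {linear N -> row n1}) : (forall y, d1 (g y) = 0) ->
  exists f : {linear N -> row n0}, forall y, d0 (f y) = g y.
Proof.
move=> d1g.
have tr_lin : linear (fun y : Nn n1 => \sum_s t (g (y s) 0 s) : k^o).
  move=> b y z; rewrite scaler_sumr -big_split; apply: eq_bigr => s _ /=.
  rewrite !ffunE; exact: (linearP (comp_lin (row_functional s) (kmap g))).
(* The trace functional of [g] factors through [pull]: if y d0 = 0 then y = z d1 by [exN], and tr(g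
   z d1) = tr(d1 g z) = 0. *)
have [y y0|mu muP] := @linear_extension _ k^o _ _ pull (mklin tr_lin).
  have [r|z zP] := exN (y := ev y).
    rewrite (row_linE d0) linear_sum big1 // => s _; rewrite linearZ_LR.
    have : pull_fun y s = 0 by rewrite [pull_fun y]y0 ffunE.
    by rewrite ffunE => ->; rewrite scaler0.
  have yE s : y s = \sum_u d1 (e s) 0 u *: z (e u).
    by rewrite -[LHS](row_lin_delta (y : 'I_n1 -> N)) zP (row_linE z).
  rewrite /=.
  under eq_bigr => s _ do rewrite yE linear_sum summxE linear_sum.
  rewrite exchange_big big1 //= => u _.
  transitivity (t (d1 (g (z (e u))) 0 u)); last by rewrite d1g mxE linear0.
  rewrite (row_linE d1) summxE linear_sum.
  by apply: eq_bigr => s _; rewrite linearZ_LR !mxE tC.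
have [f fP] := functional_lift (fun r => comp_lin mu (single r)).
exists f => y; apply: row_eq => b s.
have -> : t (b * g y 0 s) = mu (pull (single s (b *: y))).
  rewrite muP -[RHS]/(\sum_u t (g (single s (b *: y) u) 0 u)).
  rewrite (bigD1 s) //= big1 ?addr0 => [|u us].
    by rewrite ffunE eqxx linearZ_LR mxE.
  by rewrite ffunE (negPf us) linear0 mxE linear0.
have -> : pull (single s (b *: y)) = \sum_r single r (d0 (e r) 0 s *: (b *: y)).
  apply/ffunP => r; rewrite sum_ffunE (bigD1 r) //= big1 ?addr0 => [|u ur].
    rewrite !ffunE eqxx -[LHS]/(\sum_u d0 (e r) 0 u *: (single s (b *: y) u : N)).
    rewrite (bigD1 s) //= big1 ?addr0 => [|u us]; first by rewrite ffunE eqxx.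
    by rewrite ffunE (negPf us) scaler0.
  by rewrite ffunE eq_sym (negPf ur).
rewrite linear_sum (row_linE d0) summxE mulr_sumr linear_sum.
apply: eq_bigr => r _; rewrite scalerA mxE mulrA tC mulrA.
by rewrite [LHS]fP.
Qed.

End TraceDuality.

(** Since A^n is injective, a map T -> M extends to a map E -> A^n, which induces Z -> C.
    Subtracting a lift of the latter corrects the extension so that it lands in [M]. *)
Lemma ext1_lift M n C (j : {linear M -> row n}) (p : {linear row n -> C}) Z :
  ses j p ->
  (forall g : {linear Z -> C},
    exists f : {linear Z -> row n}, forall z, p (f z) = g z) ->
  ext1 Z M.
Proof.
move=> sjp lift T E i r f sir; have [i_inj r_surj exr] := sir.
have [e eP] := row_injective (comp_lin j f) i_inj.
have [y ry|g gP] := ker_factor (f := comp_lin p e) r_surj.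
  by have /exr[z <-] := ry; rewrite /= eP /= (ses0 sjp).
have [l lP] := lift g.
have [y|h hP] := ker_lift (g := sub_lin e (comp_lin l r)) sjp.
  by rewrite /= linearB lP gP subrr.
have [j_inj _ _] := sjp; exists h => z; apply: j_inj.
by rewrite hP /= eP (ses0 sir) linear0 subr0.
Qed.

(** This is dimension shifting in the second variable. *)
Lemma extv_cosyzygy M n C (j : {linear M -> row n}) (p : {linear row n -> C}) m Y :
  ses j p -> extv m Y C -> extv m.+1 Y M.
Proof.
move=> sjp; have [_ p_surj _] := sjp.
elim: m Y => [|m IH] Y extY Z P i r Pp sir; last exact: IH (extY _ _ _ _ Pp sir).
apply: (ext1_lift sjp) => g; have [g' g'P] := extY _ _ _ _ g sir.
have [l lP] := Pp _ _ p g' p_surj.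
by exists (comp_lin l i) => z; rewrite /= lP g'P.
Qed.

(** The cosyzygies give a complex A^n0 -> A^n1 -> A^n2. Vanishing of Ext^1(C3,N) makes Hom(-,N)
    exact at A^n1, and trace duality converts this into the liftings from [N] needed for
    [ext1_lift]. *)
Lemma ext1_duality M N n0 C1 (j0 : {linear M -> row n0}) (p0 : {linear row n0 -> C1})
    n1 C2 (j1 : {linear C1 -> row n1}) (p1 : {linear row n1 -> C2})
    n2 C3 (j2 : {linear C2 -> row n2}) (p2 : {linear row n2 -> C3}) :
  ses j0 p0 -> ses j1 p1 -> ses j2 p2 -> ext1 C3 N -> ext1 N M.
Proof.
move=> s0 s1 s2 extC; apply: (ext1_lift s0) => g.
have [_ p0_surj _] := s0; have [j1_inj p1_surj ex1] := s1.
have [||f fP] := @trace_duality N _ _ _ (comp_lin j1 p0) (comp_lin j2 p1) _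
  (comp_lin j1 g).
- move=> y yd; have [r r0|y' y'P] := ker_factor (f := y) p1_surj.
    have /ex1[x <-] := r0; have [u <-] := p0_surj x; exact: yd.
  have [z zP] := extC _ _ _ _ y' s2; exists z => r.
  by rewrite /= zP y'P.
- by move=> y; rewrite /= (ses0 s1) linear0.
by exists f => y; apply: j1_inj; exact: fP.
Qed.

(** Degree one is the trace duality; each higher degree is shifted down by replacing [M] with its
    cosyzygy. *)
Lemma extv_duality M N :
  (forall C m, (forall n, (m <= n)%N -> extv n C N) -> forall n, extv n C N) ->
  finitely_generated M ->
  (exists m, forall n, (m <= n)%N -> extv n M N) -> forall n, extv n N M.
Proof.
move=> gap M_fg extM n; have {}extM : forall m, extv m M N.
  by have [m /gap] := extM.
(* Dimension shifting controls Ext^i(C,N) only for i at least 2, whence the threshold 1 for [extv];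
   [gap] supplies Ext^1. *)
have shift M' k' C (j : {linear M' -> row k'}) (p : {linear row k' -> C}) :
    ses j p -> (forall m, extv m M' N) -> forall m, extv m C N.
  move=> sjp extM'; apply: (gap _ 1%N) => -[//|m] _.
  by apply/(extv_shift _ _ sjp (@row_projective A k')); exact: extM'.
elim: n M M_fg extM => [|n IH] M M_fg extM;
    have [n0 [C1 [j0 [p0 [s0 C1_fg]]]]] := cosyzygy M_fg.
  have [n1 [C2 [j1 [p1 [s1 C2_fg]]]]] := cosyzygy C1_fg.
  have [n2 [C3 [j2 [p2 [s2 _]]]]] := cosyzygy C2_fg.
  apply: (ext1_duality s0 s1 s2).
  exact: shift s2 (shift _ _ _ _ _ s1 (shift _ _ _ _ _ s0 extM)) 0%N.
exact: extv_cosyzygy s0 (IH C1 C1_fg (shift _ _ _ _ _ s0 extM)).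
Qed.

End Duality.

Theorem theorem3p3 (k : fieldType) (c : nat) (c_ge1 : (1 <= c)%N)
    (a : 'I_c -> nat) (a_ge2 : forall i, (2 <= a i)%N)
    (q : 'M[k]_c) (q_comm : commutation_matrix q)
    (A_sym : symmetric_algebra (qci q a_ge2))
    (q_root : forall i j, exists2 n : nat, (0 < n)%N & q i j ^+ n = 1)
    (M N : lmodType (qci q a_ge2))
    (M_fg : finitely_generated M) (N_fg : finitely_generated N) :
  [<-> exists n : nat, forall i : nat, (n <= i)%N -> Ext_eq0 i M N;
       forall i : nat, (0 < i)%N -> Ext_eq0 i M N;
       exists n : nat, forall i : nat, (n <= i)%N -> Ext_eq0 i N M;
       forall i : nat, (0 < i)%N -> Ext_eq0 i N M].
Proof.
have gap (U V : lmodType (qci q a_ge2)) m :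
    (forall n, (m <= n)%N -> extv n U V) -> forall n, extv n U V.
  exact: (extv_no_gap a_ge2 q_comm (qX_pow q a_ge2) (qX_com q a_ge2)
    (@qci_ind _ _ q a a_ge2) (@operator_module _ _ q a a_ge2) q_root).
have fin (U : lmodType (qci q a_ge2)) : finitely_generated U ->
    finitely_generated (kres U).
  exact: (fg_kres a_ge2 (qX_pow q a_ge2) (qX_com q a_ge2) (@qci_ind _ _ q a a_ge2)).
have [t [tC t_inj t_surj]] := symmetric_form A_sym.
(* The index moves by one, [extv i] being Ext in degree i+1. *)
have evt (U V : lmodType (qci q a_ge2)) :
    (exists n, forall i, (n <= i)%N -> Ext_eq0 i U V) ->
    exists n, forall i, (n <= i)%N -> extv i U V.
  by move=> [n ext]; exists n => i ni; apply/Ext_eq0P/ext/ltnW.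
have pos (U V : lmodType (qci q a_ge2)) :
    (forall n, extv n U V) -> forall i, (0 < i)%N -> Ext_eq0 i U V.
  by move=> ext [//|i] _; apply/Ext_eq0P.
have pos_evt (U V : lmodType (qci q a_ge2)) :
    (forall i, (0 < i)%N -> Ext_eq0 i U V) ->
    exists n, forall i, (n <= i)%N -> Ext_eq0 i U V by exists 1%N.
have dual U V (U_fg : finitely_generated U) ext :=
  extv_duality tC t_inj t_surj fin (fun C => gap C V) U_fg (evt U V ext).
(* The cycle alternates: (i) to (ii) and (iii) to (iv) come from the absence of gaps, (ii) to (iii)
   and (iv) to (i) from duality. *)
tfae=> [/evt[m /gap extMN]|extMN|/evt[m /gap extNM]|extNM].
- exact: pos.
- by apply/pos_evt/pos/dual => //; exact: pos_evt.
- exact: pos.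
- by apply/pos_evt/pos/dual => //; exact: pos_evt.
Qed.
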